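(* Let $\lambda/\mu$ be a skew shape (partitions $\mu\subseteq\lambda$). A reverse plane partition $\pi$ of shape $\lambda$ has support contained in the skew shape $\lambda/\mu$ if and only if the support of $\Phi(\pi)$ is a pleasant diagram in $\mathcal{P}(\lambda/\mu)$, where $\Phi$ is the Hillman--Grassl map. In particular, $$\sum_{\pi\in\mathrm{RPP}(\lambda/\mu)}q^{|\pi|}\;=\;\sum_{S\in\mathcal{P}(\lambda/\mu)}\ \prod_{u\in S}\frac{q^{h(u)}}{1-q^{h(u)}} .$$
   Context: $[\lambda]=\{(i,j):1\le i\le \ell(\lambda),\,1\le j\le\lambda_i\}$ is the Young diagram (rows numbered from the top, columns from the left), $\lambda'$ is the conjugate partition, and $h(i,j)=\lambda_i-i+\lambda'_j-j+1$ is the hook-length in $\lambda$. A reverse plane partition (RPP) of shape $\lambda$ (resp. $\lambda/\mu$) is a filling of $[\lambda]$ (resp. $[\lambda]\setminus[\mu]$) with nonnegative integers weakly increasing along rows and down columns; $|\pi|$ is the sum of the entries; $\mathrm{RPP}(\lambda/\mu)$ is the set of RPPs of shape $\lambda/\mu$. The support of an array is the set of cells with nonzero entry. Hillman--Grassl map $\Phi$ (from RPPs of shape $\lambda$ to arrays of nonnegative integers of shape $\lambda$): given an RPP $\pi$, start with the zero array $A$ of shape $\lambda$. While $\pi\ne 0$: let $c$ be the leftmost column of $\pi$ containing a nonzero entry; start a path at the bottom cell of column $c$; when the path is at $(i,j)$, if $i>1$ and $\pi_{i-1,j}=\pi_{i,j}$ move north to $(i-1,j)$, otherwise move east to $(i,j+1)$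 if this is a cell of $[\lambda]$; the path ends when neither move is possible, at the last cell of some row $r$. Subtract $1$ from each entry of $\pi$ on the path (the result is again an RPP), and add $1$ to $A_{r,c}$. When $\pi$ becomes zero, $\Phi(\pi)$ is the final array $A$. Pleasant diagrams: for an integer $k$ with $1-\ell(\lambda)\le k\le\lambda_1-1$, let $\mathsf{d}_k=\{(i,j)\in[\lambda]\setminus[\mu]: j-i=k\}$, let $s_k=|\mathsf{d}_k|$, and let $\square_k^\lambda$ be the largest rectangle with $i$ rows and $i+k$ columns, with northwest corner $(1,1)$, that fits inside $[\lambda]$. A descending chain of length $s$ in a set of cells is a sequence of cells $(i_1,j_1),\ldots,(i_s,j_s)$ of the set with $i_1<\cdots<i_s$ and $j_1<\cdots<j_s$. A subset $S\subseteq[\lambda]$ is a pleasant diagram of $\lambda/\mu$ if for every $k$ with $1-\ell(\lambda)\le k\le\lambda_1-1$, every descending chain in $S\cap\square_k^\lambda$ has length at most $s_k$; $\mathcal{P}(\lambda/\mu)$ is the set of these. *)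

(* Defs.v *)
From HB Require Import structures.
From mathcomp Require Import all_boot all_order all_algebra.
From mathcomp Require Import boolp classical_sets cardinality fsbigop.

Set Implicit Arguments.
Unset Strict Implicit.
Unset Printing Implicit Defensive.

Import Order.TTheory GRing.Theory Num.Theory.

Local Open Scope nat_scope.

(* Rows and columns are numbered from 0, so the cell written (i, j) here is the
   cell (i+1, j+1) of the usual convention; the content j - i is unaffected. *)

Definition is_partition (la : seq nat) : bool :=
  sorted geq la && (0 \notin la).

Definition part (la : seq nat) (i : nat) : nat := nth 0 la i.

Definition conj_part (la : seq nat) (j : nat) : nat :=
  count (fun r => j < r) la.

Definition diagram (la : seq nat) : seq (nat * nat) :=
  [seq (i, j) | i <- iota 0 (size la), j <- iota 0 (part la i)].

Definition skew_diagram (la mu : seq nat) : seq (nat * nat) :=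
  [seq c <- diagram la | c \notin diagram mu].

(* With rows and columns numbered from 1 this is la_i - i + la'_j - j + 1. *)
Definition hook (la : seq nat) (c : nat * nat) : nat :=
  part la c.1 + conj_part la c.2 - (c.1 + c.2).+1.

Section Fillings.
Variable D : seq (nat * nat).

Definition cell : finType := seq_sub D.
Definition row_of (u : cell) : nat := (val u).1.
Definition col_of (u : cell) : nat := (val u).2.

Definition filling := {ffun cell -> nat}.

Definition is_rpp (pi : filling) : bool :=
  [forall u, forall v,
    [|| (row_of u == row_of v) && (col_of u <= col_of v)
      | (col_of u == col_of v) && (row_of u <= row_of v)] ==> (pi u <= pi v)].

Definition weight (pi : filling) : nat := \sum_u pi u.

Definition supp (pi : filling) : {set cell} := [set u | pi u != 0].

Definition zero_filling : filling := [ffun=> 0].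

Definition cell_at (i j : nat) : option cell := insub (i, j).

End Fillings.

Section HillmanGrassl.
Variable la : seq nat.
Local Notation cell := (cell (diagram la)).
Local Notation filling := (filling (diagram la)).

(* When pi = 0 this is part la 0, which is past the last column. *)
Definition hg_column (pi : filling) : nat :=
  find (fun j => [exists u : cell, (col_of u == j) && (pi u != 0)])
       (iota 0 (part la 0)).

Definition bottom_cell (c : nat) : option cell :=
  cell_at (diagram la) (conj_part la c).-1 c.

Definition east (u : cell) : option cell :=
  cell_at (diagram la) (row_of u) (col_of u).+1.

Definition north (u : cell) : option cell :=
  if row_of u is i.+1 then cell_at (diagram la) i (col_of u) else None.

Definition hg_next (pi : filling) (u : cell) : option cell :=
  if north u is Some v then
    if pi v == pi u then Some v else east u
  else east u.

(* The cells visited after u, at most n of them. *)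
Fixpoint hg_path (pi : filling) (n : nat) (u : cell) : seq cell :=
  if n is n'.+1 then
    if hg_next pi u is Some v then v :: hg_path pi n' v else [::]
  else [::].

(* A path never visits a cell twice, so the bound #|cell| does not cut it.
   All the entries on the path are positive when pi is a nonzero RPP, so the
   subtraction is a genuine one. *)
Definition hg_step (piA : filling * filling) : filling * filling :=
  let: (pi, A) := piA in
  if pi == zero_filling _ then (pi, A) else
  let c := hg_column pi in
  if bottom_cell c is Some b then
    let p := hg_path pi #|cell| b in
    let r := row_of (last b p) in
    ([ffun u => pi u - (u \in b :: p)],
     [ffun u => A u + ((row_of u == r) && (col_of u == c))])
  else (pi, A).

(* Every step on a nonzero RPP decreases the weight, so weight pi steps reach
   the zero filling, on which hg_step is the identity. *)
Definition hillman_grassl (pi : filling) : filling :=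
  (iter (weight pi) hg_step (pi, zero_filling _)).2.

End HillmanGrassl.

Section Pleasant.
Variables la mu : seq nat.
Local Notation cell := (cell (diagram la)).

Definition skew_diagonal (k : int) : seq (nat * nat) :=
  [seq c <- skew_diagram la mu | (c.2%:Z - c.1%:Z == k)%R].

(* The rectangle with i rows, i + k columns and northwest corner (0, 0) is
   contained in the diagram of la. *)
Definition rect_fits (k : int) (i : nat) : bool :=
  (0 <= i%:Z + k)%R &&
  [forall a : 'I_i, forall b : 'I_(absz (i%:Z + k)%R),
    (val a, val b) \in diagram la].

(* For 1 - size la <= k <= part la 0 - 1 a largest fitting rectangle exists, is
   nonempty, and has at most size la rows. *)
Definition rect_rows (k : int) : nat :=
  \max_(i < (size la).+1 | rect_fits k i) i.

Definition rect (k : int) : {set cell} :=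
  [set u | (row_of u < rect_rows k) &&
           ((col_of u)%:Z < (rect_rows k)%:Z + k)%R].

Definition descending_chain (s : seq cell) : bool :=
  sorted (fun u v => (row_of u < row_of v) && (col_of u < col_of v)) s.

Definition pleasant (S : {set cell}) : Prop :=
  forall k : int,
    (1 - (size la)%:Z <= k <= (part la 0)%:Z - 1)%R ->
  forall s : seq cell,
    {subset s <= S :&: rect k} -> descending_chain s ->
    size s <= size (skew_diagonal k).

End Pleasant.

Local Open Scope ring_scope.

Record fps (R : Type) := Fps { fcoef : nat -> R }.

HB.instance Definition _ (R : Type) := gen_eqMixin (fps R).
HB.instance Definition _ (R : Type) := gen_choiceMixin (fps R).

Lemma fpsP (R : Type) (f g : fps R) : fcoef f =1 fcoef g -> f = g.
Proof. by case: f g => [f] [g] /= /funext ->. Qed.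

Section FpsRing.
Variable R : comNzRingType.
Implicit Types f g h : fps R.

Definition fps_zero : fps R := Fps (fun=> 0).
Definition fps_opp f := Fps (fun n => - fcoef f n).
Definition fps_add f g := Fps (fun n => fcoef f n + fcoef g n).

Lemma fps_addA : associative fps_add.
Proof. by move=> f g h; apply: fpsP => n /=; rewrite addrA. Qed.
Lemma fps_addC : commutative fps_add.
Proof. by move=> f g; apply: fpsP => n /=; rewrite addrC. Qed.
Lemma fps_add0 : left_id fps_zero fps_add.
Proof. by move=> f; apply: fpsP => n /=; rewrite add0r. Qed.
Lemma fps_addN : left_inverse fps_zero fps_opp fps_add.
Proof. by move=> f; apply: fpsP => n /=; rewrite addNr. Qed.

HB.instance Definition _ :=
  GRing.isZmodule.Build (fps R) fps_addA fps_addC fps_add0 fps_addN.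

Definition fps_one : fps R := Fps (fun n => (n == 0)%:R).
Definition fps_mul f g :=
  Fps (fun n => \sum_(i < n.+1) fcoef f i * fcoef g (n - i)).

Definition fps_trunc n f : {poly R} := \poly_(i < n) fcoef f i.

Lemma coef_fps_trunc n f i : (i < n)%N -> (fps_trunc n f)`_i = fcoef f i.
Proof. by move=> lt_in; rewrite coef_poly lt_in. Qed.

Lemma fcoef_mul_poly n (p q : {poly R}) f g :
    (forall i, (i < n)%N -> p`_i = fcoef f i) ->
    (forall i, (i < n)%N -> q`_i = fcoef g i) ->
  forall i, (i < n)%N -> (p * q)`_i = fcoef (fps_mul f g) i.
Proof.
move=> pf qg i lt_in; rewrite coefM /=; apply: eq_bigr => j _.
rewrite pf ?qg //; first exact: leq_ltn_trans (leq_subr _ _) lt_in.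
by rewrite (leq_ltn_trans _ lt_in) // -ltnS.
Qed.

Lemma fps_mulA : associative fps_mul.
Proof.
move=> f g h; apply: fpsP => n; set t := fps_trunc n.+1.
have tP k : forall i, (i < n.+1)%N -> (t k)`_i = fcoef k i.
  by move=> i; exact: coef_fps_trunc.
have lt_nn := ltnSn n.
have fP := fcoef_mul_poly (tP f) (fcoef_mul_poly (tP g) (tP h)) lt_nn.
have gP := fcoef_mul_poly (fcoef_mul_poly (tP f) (tP g)) (tP h) lt_nn.
by rewrite -fP -gP mulrA.
Qed.

Lemma fps_mulC : commutative fps_mul.
Proof.
move=> f g; apply: fpsP => n; set t := fps_trunc n.+1.
have tP k : forall i, (i < n.+1)%N -> (t k)`_i = fcoef k i.
  by move=> i; exact: coef_fps_trunc.
have lt_nn := ltnSn n.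
rewrite -(fcoef_mul_poly (tP f) (tP g) lt_nn) mulrC.
exact: (fcoef_mul_poly (tP g) (tP f) lt_nn).
Qed.

Lemma fps_mul1 : left_id fps_one fps_mul.
Proof.
move=> f; apply: fpsP => n /=; rewrite big_ord_recl /= mul1r subn0.
by rewrite big1 ?addr0 // => i _; rewrite mul0r.
Qed.

Lemma fps_mulDl : left_distributive fps_mul fps_add.
Proof.
move=> f g h; apply: fpsP => n /=; rewrite -big_split /=.
by apply: eq_bigr => i _; rewrite mulrDl.
Qed.

Lemma fps_one_neq0 : fps_one != fps_zero.
Proof.
by apply/eqP => /(congr1 (fun f => fcoef f 0))/eqP; rewrite /= oner_eq0.
Qed.

HB.instance Definition _ := GRing.Zmodule_isComNzRing.Build (fps R)
  fps_mulA fps_mulC fps_mul1 fps_mulDl fps_one_neq0.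

Definition fps_unit : {pred fps R} := fun f => `[< exists g, g * f = 1 >].

Definition fps_inv f : fps R :=
  if pselect (exists g, g * f = 1) is left fU then projT1 (cid fU) else f.

Lemma fps_mulVf : {in fps_unit, left_inverse 1 fps_inv *%R}.
Proof.
move=> f /asboolP fU; rewrite /fps_inv; case: pselect => // fU'.
by case: (cid fU').
Qed.

Lemma fps_unitPl f g : g * f = 1 -> fps_unit f.
Proof. by move=> gf1; apply/asboolP; exists g. Qed.

Lemma fps_inv_out : {in [predC fps_unit], fps_inv =1 id}.
Proof.
move=> f /negP fNU; rewrite /fps_inv; case: pselect => // fU.
by case: fNU; apply/asboolP.
Qed.

HB.instance Definition _ := GRing.ComNzRing_hasMulInverse.Build (fps R)
  fps_mulVf fps_unitPl fps_inv_out.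

Definition fpsX : fps R := Fps (fun n => (n == 1)%:R).

Lemma fcoef_XM f n :
  fcoef (fpsX * f) n = if n is n'.+1 then fcoef f n' else 0.
Proof.
transitivity (\sum_(i < n.+1) (i == 1 :> nat)%:R * fcoef f (n - i)) => //.
case: n => [|n]; first by rewrite big_ord_recl big_ord0 mul0r addr0.
rewrite !big_ord_recl mul0r add0r mul1r big1 ?addr0 => [|i _].
  by rewrite subSS subn0.
by rewrite mul0r.
Qed.

Lemma fcoef_XnM m f n :
  fcoef (fpsX ^+ m * f) n = if (n < m)%N then 0 else fcoef f (n - m).
Proof.
elim: m n => [|m IHm] n; first by rewrite expr0 mul1r subn0.
by rewrite exprS -mulrA fcoef_XM; case: n => [|n] //; rewrite IHm ltnS subSS.
Qed.

Lemma fcoef_Xn m n : fcoef (fpsX ^+ m) n = (n == m)%:R.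
Proof.
rewrite -[fpsX ^+ m]mulr1 fcoef_XnM /=.
by case: ltngtP => [//|lt_mn|->]; rewrite ?subnn // subn_eq0 leqNgt lt_mn.
Qed.

(* The quotients q^h / (1 - q^h) of the hook formula are genuine quotients. *)
Lemma unit_1subXn m : (0 < m)%N -> 1 - fpsX ^+ m \is a GRing.unit.
Proof.
move=> m_gt0; pose g := Fps (fun n => (m %| n)%:R : R).
apply: (@fps_unitPl _ g); rewrite mulrC mulrBl mul1r; apply: fpsP => n.
transitivity (fcoef g n - fcoef (fpsX ^+ m * g) n) => //.
rewrite fcoef_XnM [fcoef 1 n]/=.
case: ltnP => [lt_nm | le_mn].
  by rewrite subr0 /=; case: n lt_nm => [|n] ltn; rewrite ?dvdn0 ?gtnNdvd.
rewrite /= dvdn_subl ?dvdnn // subrr; case: eqP => // n0.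
by move: le_mn; rewrite n0 leqNgt m_gt0.
Qed.

(* The family (F i), i in A, is summable with sum f: each coefficient of f is
   the sum of finitely many nonzero contributions. *)
Definition has_fps_sum (I : choiceType) (A : set I) (F : I -> fps R)
    (f : fps R) : Prop :=
  forall n,
    finite_set [set i | A i /\ fcoef (F i) n <> 0]%classic /\
    fcoef f n = \sum_(i \in A) fcoef (F i) n.

End FpsRing.

Arguments fpsX {R}.

(* Main.v *)
Require Import Defs.
From HB Require Import structures.
From mathcomp Require Import all_boot all_order all_algebra.
From mathcomp Require Import boolp classical_sets cardinality fsbigop.
From mathcomp Require Import zify.

Set Implicit Arguments.
Unset Strict Implicit.
Unset Printing Implicit Defensive.

Import Order.TTheory GRing.Theory Num.Theory.

Local Open Scope nat_scope.

(* The idea is to delete a corner x of the shape. If pi is a reverse plane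
   partition, changing only the entries on the diagonal of x, by an invertible
   local rule, gives a reverse plane partition of the smaller shape, together
   with a number a, such that the Hillman--Grassl paths of both fillings agree
   off that diagonal; the map then gives a to x and is unchanged elsewhere. By
   induction on the shape this makes the map bijective. The number of nonzero
   entries on the diagonal ending at a boundary cell (p, q) moreover satisfies
     L(p, q) = max (L(p - 1, q), L(p, q - 1), L(p - 1, q - 1) + [A(p, q) > 0]),
   where A is the image of pi, so it is the length of the longest descending
   chain in the support of A inside the rectangle with corner (p, q). The support
   of pi avoids mu exactly when these numbers are at most the s_k. A path from
   column c to row r has length the hook length of (r, c), which yields the
   weights of the generating function. *)

(** * Corner deletion on one diagonal *)

(** Corner deletion changes a whole diagonal at once, whereas the algorithm proceeds path by path,
    so a closed formula for one is of little use for the other. Deletion is therefore a relation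
    between fillings f and g, certified by an existentially quantified carry sequence, and each path
    of f is shown to preserve this relation. The corner removed is always the end (n, q) of the last
    row: a path from a column left of q starts in row n and meets the diagonal in exactly one cell,
    a path from column q starts at the corner itself, and a path from a column right of q never
    reaches the diagonal. In the first case the paths of f and g may separate on the diagonal, and
    the carry sequence has to be updated. Counting is enough to compare supports: the positive
    entries of a reverse plane partition fill a segment of each diagonal that ends at the boundary,
    and so do the cells outside mu. Two such segments are nested according to their lengths. *)

(* Q and P are read, moving away from the corner, on the diagonal of a corner
   cell before and after its deletion; mu and nu on the diagonals just below and
   just above it. Index 0 of mu, nu and P is not used. *)
Definition interlacing (mu nu Q P : nat -> nat) : Prop :=
  forall t,
    (mu t.+1 <= Q t /\ nu t.+1 <= Q t /\
     Q t.+1 <= mu t.+1 /\ Q t.+1 <= nu t.+1) /\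
    (P t.+1 <= mu t.+1 /\ P t.+1 <= nu t.+1 /\
     mu t.+2 <= P t.+1 /\ nu t.+2 <= P t.+1).

(* The local growth rule of Burge's variant of RSK: the multiplicity a enters far
   away from the corner and C is the load carried towards the corner, filling
   each entry Q up to at most P. Unlike in the toggle rule of RSK, the number of
   nonzero entries of Q depends only on those of mu, nu, P and on a. *)
Definition carry_rule (mu nu Q P C : nat -> nat) (a n : nat) : Prop :=
  [/\ Q 0 = maxn (mu 1) (nu 1) + C 0,
      forall t, Q t.+1 = minn (maxn (mu t.+2) (nu t.+2) + C t.+1) (P t.+1),
      forall t, C t + Q t.+1 + P t.+1 =
                C t.+1 + maxn (mu t.+2) (nu t.+2) + minn (mu t.+1) (nu t.+1)
    & forall t, n <= t -> C t = a].

(* How a Hillman--Grassl path traverses the diagonal: it comes from mu m.+1, goes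
   through Q l in the large shape and P p in the small one, and leaves through
   nu k. An index 0 for p or k means that the path ends instead. *)
Definition crossing (mu nu Q P : nat -> nat) (m l p k : nat) : Prop :=
  [\/ [/\ l = m.+1, p = m.+1, k = m.+2 &
          [/\ Q m.+1 = mu m.+1, P m.+1 = mu m.+1 & nu m.+2 = mu m.+1]],
      [/\ l = m, p = m, k = m &
          [/\ Q m.+1 < mu m.+1, P m.+1 < mu m.+1, nu m.+1 < Q m
            & 0 < m -> nu m.+1 < P m]]
    | k = m.+1 /\
      [\/ [/\ l = m.+1, p = m.+1, Q m.+1 = mu m.+1 & P m.+1 = mu m.+1],
          [/\ l = m, p = m.+1, Q m.+1 < mu m.+1 &
              P m.+1 = mu m.+1 /\ nu m.+1 = Q m]
        | [/\ l = m, p = m, Q m.+1 < mu m.+1 &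
              [/\ P m.+1 < mu m.+1, 0 < m, P m = nu m.+1 & nu m.+1 = Q m]]]].

Definition incr (s : nat -> nat) (k t : nat) := s t + (t == k).

(** Position of a diagonal index relative to the crossing point. Offsets are explicit, so that after
    substitution every test in [incr] and [carry_step] compares shifts of one variable. *)
Lemma nearby t m :
  [\/ t = m, t = m.+1, m = t.+1
    | m = t.+2 \/ (exists d, t = m + d.+2) \/ (exists d, m = t + d.+3)].
Proof.
have [?|[?|[?|[?|[?|?]]]]] : t = m \/ t = m.+1 \/ m = t.+1 \/ m = t.+2 \/
  m.+2 <= t \/ t.+3 <= m by lia.
- by constructor 1.
- by constructor 2.
- by constructor 3.
- by constructor 4; left.
- by constructor 4; right; left; exists (t - m.+2); lia.
- by constructor 4; right; right; exists (m - t.+3); lia.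
Qed.

Ltac case_crossing :=
  case=> [[-> -> -> [+ + +]]|[-> -> -> [+ + + +]]
    |[-> [[-> -> + +]|[-> -> + [+ +]]|[-> -> + [+ + + +]]]]].

Ltac generalize_minmax :=
  repeat match goal with
  | |- context [maxn ?x ?y] => move: (addn_min_max x y); move: (maxn x y) => ?
  end;
  repeat match goal with
  | |- context [minn ?x ?y] => move: (minn x y) => ?
  end.

Section CarryStep.
Variables (mu nu Q P C : nat -> nat) (a n m l p k : nat).
Local Notation mu1 := (incr mu m.+1).
Local Notation nu1 := (incr nu k).
Local Notation Q1 := (incr Q l).
Local Notation P1 := (incr P p).

(** Here [mu1], [nu1], [Q1], [P1] come before the subtraction of a path and [mu], [nu], [Q], [P]
    after it. Since max + min is the sum of both arguments, the conservation law telescopes: C t -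
    min (mu t.+1) (nu t.+1) is a plus the sum over s > t of mu s.+1 + nu s.+1 - Q s - P s. The path
    changes this sum by the four truth values of the formula, which forces the new carry. *)
Definition carry_step t :=
  (C t + minn (mu t.+1) (nu t.+1) + (t < l) + (t < p)) -
   (minn (mu1 t.+1) (nu1 t.+1) + (t < m) + (t.+1 < k)).

Hypotheses (I : interlacing mu nu Q P) (I1 : interlacing mu1 nu1 Q1 P1)
  (R : carry_rule mu1 nu1 Q1 P1 C a n) (nu0 : forall t, n <= t -> nu1 t = 0)
  (X : crossing mu1 nu1 Q1 P1 m l p k).

(** The subtraction in [carry_step] is never truncated, so the new carry may be handled through an
    additive equation. *)
Lemma carry_stepE t :
 carry_step t + (minn (mu1 t.+1) (nu1 t.+1) + (t < m) + (t.+1 < k)) =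
 C t + minn (mu t.+1) (nu t.+1) + (t < l) + (t < p).
Proof.
case: R => [R0 RQ RC Ra]; rewrite /carry_step subnK //.
move: X (I t) (I1 t) (RC t) (RQ t); clear.
case: (nearby t m) => [->|->|->|[->|[[d ->]|[d ->]]]]; case_crossing; unfold incr.
all: lia.
Qed.

(** Conservation holds by the choice of [carry_step]; the point is that the capped filling rule
    survives. Near the crossing, the equalities and strict inequalities recorded by the path decide
    how each max and min reacts to the decrement. *)
Lemma carry_rule_decr : carry_rule mu nu Q P carry_step a n.
Proof.
have E := carry_stepE.
case: R => [R0 RQ RC Ra].
(* An entry not filled up to its cap has absorbed the whole load arriving at it; what is passed on
   is only the gap between the cap and the min. *)
have drained t : Q1 t.+1 < P1 t.+1 -> C t + P1 t.+1 = minn (mu1 t.+1) (nu1 t.+1).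
  by move: (RQ t) (RC t); clear; lia.
split.
{ have : [\/ m = 0, m = 1 | exists d, m = d.+2].
    by case: (m) => [|[|d]]; [constructor 1|constructor 2|constructor 3; exists d].
  move: X (I 0) (I1 0) (E 0) (RC 0) R0; clear => X.
  move: (carry_step 0) => c => + + + + +  h; move: X.
  case: h => [->|->|[d ->]]; case_crossing; unfold incr;
  intros; lia. }
{ move=> t; move: X (I t) (I1 t) (E t.+1) (RC t) (RQ t) (drained t.+1).
  move: (carry_step t.+1) => c; clear.
  case: (nearby t m) => [->|->|->|[->|[[d ->]|[d ->]]]]; case_crossing; unfold incr;
  intros; lia. }
{ move=> t; move: X (E t) (E t.+1) (RC t).
  move: (carry_step t.+1) => c.
  move: (carry_step t) => c'; clear.
  case: (nearby t m) => [->|->|->|[->|[[d ->]|[d ->]]]]; case_crossing; unfold incr;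
   generalize_minmax; intros; lia. }
move=> t nt.
  move: X (E t) (I t) (I1 t) (Ra t nt) (nu0 nt) (nu0 (leqW nt)) (nt) (nu0).
  move: (carry_step t) => c; clear.
  case: (nearby t m) => [->|->|->|[->|[[d ->]|[d ->]]]]; case_crossing; unfold incr;
  intros; lia.
Qed.
End CarryStep.

(** * Fillings of a shape and Hillman-Grassl paths *)

Section Shape.
Variable D : nat -> nat.

(* Rows and columns are numbered from 1 and fillings vanish on row 0 and column
   0, so that a path through positive entries meets no boundary case. *)
Definition in_shape i j := (0 < i) && (0 < j <= D i).

Definition rpp_on (f : nat -> nat -> nat) : Prop :=
  [/\ forall i j, ~~ in_shape i j -> f i j = 0,
      forall i j, in_shape i.+1 j -> f i j <= f i.+1 j
    & forall i j, in_shape i j.+1 -> f i j <= f i j.+1].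

Inductive walk (f : nat -> nat -> nat) : nat -> nat -> seq (nat * nat) -> Prop :=
| walk_north i j w of f i.-1 j == f i j & walk f i.-1 j w :
    walk f i j ((i, j) :: w)
| walk_east i j w of f i.-1 j != f i j & j < D i & walk f i j.+1 w :
    walk f i j ((i, j) :: w)
| walk_stop i j of f i.-1 j != f i j & D i <= j : walk f i j [:: (i, j)].

Definition sub_walk (f : nat -> nat -> nat) (w : seq (nat * nat)) i j :=
  f i j - ((i, j) \in w).

(** The graph of the Hillman--Grassl map. The first path is peeled off outermost, so that proofs can
    go by induction on the derivation; [c] is the leftmost nonzero column and [b] its bottom row. *)
Inductive hg (f A : nat -> nat -> nat) : Prop :=
| hg_zero of (forall i j, f i j = 0) & (forall i j, A i j = 0)
| hg_cons B b c w of 0 < f b c & ~~ in_shape b.+1 c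
    & (forall i j, j < c -> f i j = 0) & walk f b c w & hg (sub_walk f w) B
    & (forall i j, A i j = B i j + ((i == (last (b, c) w).1) && (j == c))).

Lemma hg_ext f A A' : (forall i j, A i j = A' i j) -> hg f A -> hg f A'.
Proof.
move=> e [f0 A0|B b c w h1 h2 h3 h4 h5 AB].
  by apply: hg_zero => // i j; rewrite -e.
by apply: (hg_cons h1 h2 h3 h4 h5) => i j; rewrite -e AB.
Qed.

Hypothesis Dmono : forall i, 0 < i -> D i.+1 <= D i.

Lemma shape_le i i' : 0 < i -> i <= i' -> D i' <= D i.
Proof.
move=> i0 /subnKC <-; elim: (i' - i) => [|d IH]; first by rewrite addn0.
by rewrite addnS (leq_trans _ IH) // Dmono // addn_gt0 i0.
Qed.

Lemma in_shape_le i j i' j' :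
  in_shape i' j' -> 0 < i <= i' -> 0 < j <= j' -> in_shape i j.
Proof.
rewrite /in_shape => /and3P [_ _ h] /andP [i0 ii] /andP [j0 jj].
by rewrite i0 j0 (leq_trans jj) // (leq_trans h) // shape_le.
Qed.

Lemma last_walk f i j w u v : walk f i j w -> last u w = last v w.
Proof. by case. Qed.

Section Rpp.
Variable f : nat -> nat -> nat.
Hypothesis fP : rpp_on f.

Lemma rpp_gt0 i j : 0 < f i j -> in_shape i j.
Proof. by case: fP => f0 _ _; apply: contraLR => /f0 ->. Qed.

Lemma rpp_row0 j : f 0 j = 0.
Proof. by case: fP => f0 _ _; apply: f0. Qed.

Lemma rpp_col0 i : f i 0 = 0.
Proof. by case: fP => f0 _ _; apply: f0; rewrite /in_shape /= andbF. Qed.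

Lemma rpp_north i j : in_shape i j -> f i.-1 j <= f i j.
Proof. by case: fP => _ fN _; case: i => [|i] // /fN. Qed.

Lemma rpp_west i j : in_shape i j -> f i j.-1 <= f i j.
Proof. by case: fP => _ _ fW; case: j => [|j] // /fW. Qed.

Lemma rpp_le i j i' j' : in_shape i' j' -> i <= i' -> j <= j' -> f i j <= f i' j'.
Proof.
move=> h ii jj; have [i0|i0] := posnP i; first by rewrite i0 rpp_row0.
have [j0|j0] := posnP j; first by rewrite j0 rpp_col0.
have h1 : f i j <= f i j'.
  elim: j' jj h => [|j' IH]; first by rewrite leqn0 => /eqP ->.
  rewrite leq_eqVlt => /predU1P [<- //|jj] h.
  have h' : in_shape i j'.+1 by apply: in_shape_le h _ _; lia.
  apply: leq_trans (rpp_west h'); apply: IH => //.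
  by apply: in_shape_le h _ _; lia.
apply: leq_trans h1 _.
elim: i' ii h => [|i' IH]; first by rewrite leqn0 => /eqP ->.
rewrite leq_eqVlt => /predU1P [<- //|ii] h.
apply: leq_trans (rpp_north h); apply: IH => //.
by apply: in_shape_le h _ _; lia.
Qed.

Lemma walk_exists i j : 0 < f i j -> exists w, walk f i j w.
Proof.
(* This measure drops at every step north or east; [D 1] bounds all column indices. *)
have [k] := ubnP (i + (D 1 - j)); elim: k i j => // k IH i j lek fij.
have ij := rpp_gt0 fij; have /and3P[i0 j0 jD] := ij.
have [e|ne] := boolP (f i.-1 j == f i j).
  have [|| w W] := IH i.-1 j; [by lia|by rewrite (eqP e)|].
  by exists ((i, j) :: w); apply: walk_north.
have [le|lt] := leqP (D i) j; first by exists [:: (i, j)]; apply: walk_stop.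
have D1 := shape_le (ltn0Sn 0) i0.
have [|| w W] := IH i j.+1; first by lia.
  by apply: leq_trans fij (rpp_le _ _ _) => //; rewrite /in_shape i0.
by exists ((i, j) :: w); apply: walk_east.
Qed.

(** The content y - x grows strictly along the path, which gives the last alternative and rules out
    repeated cells. *)
Lemma walk_mem i j w x y : walk f i j w -> 0 < f i j -> (x, y) \in w ->
  [/\ 0 < f x y, x <= i, j <= y & (x, y) = (i, j) \/ x + j < y + i].
Proof.
move=> W; elim: W x y => {i j w} [i j w e W IH|i j w ne lt W IH|i j ne le] x y fij.
- rewrite inE => /predU1P [[-> ->]|/IH]; first by split=> //; left.
  rewrite (eqP e) => /(_ fij) [? ? ? h].
  have /andP[i0 _] := rpp_gt0 fij.
  by split=> //; [lia|case: h => [[-> ->]|h]; right; lia].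
- rewrite inE => /predU1P [[-> ->]|/IH]; first by split=> //; left.
  have /and3P[i0 j0 _] := rpp_gt0 fij.
  have f1 : 0 < f i j.+1.
    by apply: leq_trans fij (rpp_le _ _ _) => //; rewrite /in_shape i0.
  case/(_ f1) => ? ? ? h.
  by split=> //; [lia|case: h => [[-> ->]|h]; right; lia].
- by rewrite inE => /eqP [-> ->]; split=> //; left.
Qed.

Lemma walk_head i j w : walk f i j w -> (i, j) \in w.
Proof. by case=> *; apply: mem_head. Qed.

Lemma walk_uniq i j w : walk f i j w -> 0 < f i j -> uniq w.
Proof.
move=> W; elim: W => {i j w} [i j w e W IH|i j w ne lt W IH|i j ne le] fij //=.
- have := fij; rewrite -(eqP e) => fij'; rewrite IH // andbT; apply/negP => m.
  have /andP[i0 _] := rpp_gt0 fij.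
  by case: (walk_mem W fij' m); lia.
- have /and3P[i0 j0 _] := rpp_gt0 fij.
  have f1 : 0 < f i j.+1.
    by apply: leq_trans fij (rpp_le _ _ _) => //; rewrite /in_shape i0.
  by rewrite IH // andbT; apply/negP => m; case: (walk_mem W f1 m); lia.
Qed.

(** A path from (i, j) to the end of row r makes i - r steps north and D r - j steps east. When i is
    the bottom of column j, the size is the hook length of (r, j). *)
Lemma walk_size i j w : walk f i j w -> 0 < f i j ->
  [/\ 0 < (last (i, j) w).1 <= i, j <= D (last (i, j) w).1 &
   size w + (last (i, j) w).1 + j = i + D (last (i, j) w).1 + 1].
Proof.
move=> W; elim: W => {i j w} [i j w e W IH|i j w ne lt W IH|i j ne le] fij /=.
- have := fij; rewrite -(eqP e) => /IH; rewrite (last_walk _ (i, j) W).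
  have /andP[i0 _] := rpp_gt0 fij; move: (last _ _).1 => r; case=> *; split; lia.
- have /and3P[i0 j0 _] := rpp_gt0 fij.
  have /IH : 0 < f i j.+1.
    by apply: leq_trans fij (rpp_le _ _ _) => //; rewrite /in_shape i0.
  rewrite (last_walk _ (i, j) W).
  move: (last _ _).1 => r; case=> *; split; lia.
- by have /and3P[i0 j0 h] := rpp_gt0 fij; split; lia.
Qed.

(* The invariant carried along the walk is that the column to the left is
   strictly smaller above the current row, so that no inequality breaks. *)
Lemma walk_strict i j w : walk f i j w -> 0 < f i j ->
    (forall i', i' < i -> f i' j.-1 < f i j) ->
  forall x y, (x, y) \in w ->
    ((x.-1, y) \in w \/ f x.-1 y < f x y) /\
    ((x, y) = (i, j) \/ (x, y.-1) \in w \/ f x y.-1 < f x y).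
Proof.
move=> W; elim: W => {i j w} [i j w e W IH|i j w ne lt W IH|i j ne le] fij inv x y.
- have fij' : 0 < f i.-1 j by rewrite (eqP e).
  rewrite inE => /predU1P [[-> ->]|m].
    by split; left; rewrite // inE (walk_head W) orbT.
  have /andP[i0 _] := rpp_gt0 fij.
  have inv' i' : i' < i.-1 -> f i' j.-1 < f i.-1 j.
    by move=> h; rewrite (eqP e) inv //; lia.
  have [h1 h2] := IH fij' inv' x y m; split.
    by case: h1 => [h1|h1]; [left; rewrite inE h1 orbT|right].
  case: h2 => [[-> ->]|[h2|h2]]; right; [right|left|by right].
    by rewrite (eqP e) inv //; lia.
  by rewrite inE h2 orbT.
- have ij := rpp_gt0 fij; have /and3P[i0 j0 _] := ij.
  have fN : f i.-1 j < f i j by rewrite ltn_neqAle ne rpp_north.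
  have ij1 : in_shape i j.+1 by rewrite /in_shape i0.
  have fE : f i j <= f i j.+1 by apply: rpp_le.
  rewrite inE => /predU1P [[-> ->]|m]; first by split; [right|left].
  have f1 := leq_trans fij fE.
  have inv' i' : i' < i -> f i' j < f i j.+1.
    move=> h; apply: leq_trans fE; have [->|i'0] := posnP i'.
      by rewrite rpp_row0.
    apply: leq_ltn_trans fN.
    apply: rpp_le; [|lia|by []].
    by apply: in_shape_le ij _ _; lia.
  have [h1 h2] := IH f1 inv' x y m; split.
    by case: h1 => [h1|h1]; [left; rewrite inE h1 orbT|right].
  case: h2 => [[-> ->]|[h2|h2]]; right; [left|left|by right].
    by rewrite /= mem_head.
  by rewrite inE h2 orbT.
- rewrite inE => /eqP [-> ->]; split; [right|by left].
  by rewrite ltn_neqAle ne rpp_north // rpp_gt0.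
Qed.

(** Where a cell is decremented but its north or west neighbour is not, [walk_strict] leaves a
    strict inequality to spare. West of the starting cell the entries vanish. *)
Lemma rpp_sub_walk i j w : walk f i j w -> 0 < f i j ->
  (forall x y, y < j -> f x y = 0) -> rpp_on (sub_walk f w).
Proof.
move=> W fij z.
have ij := rpp_gt0 fij; have /and3P[i0 j0 _] := ij.
have inv i' : i' < i -> f i' j.-1 < f i j by move=> _; rewrite z //; lia.
have S := walk_strict W fij inv.
case: (fP) => f0 fN fW; split=> x y h; rewrite /sub_walk.
- by rewrite f0.
- have := fN x y h; have [m|_] := boolP ((x.+1, y) \in w); last by lia.
  by have [[/= -> |/= ? ?] _] := S _ _ m; lia.
- have := fW x y h; have [m|_] := boolP ((x, y.+1) \in w); last by lia.
  have [_ [[ex ey]|[/= -> |/= ? ?]]] := S _ _ m; [|lia|lia].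
  by rewrite (z x y) //; lia.
Qed.

Lemma sub_walkK i j w x y : walk f i j w -> 0 < f i j ->
  f x y = sub_walk f w x y + ((x, y) \in w).
Proof.
move=> W fij; rewrite /sub_walk.
by have [/(walk_mem W fij) []|] := boolP ((x, y) \in w); lia.
Qed.

End Rpp.

Lemma walk_det f i j w w' : walk f i j w -> walk f i j w' -> w = w'.
Proof.
move=> W; elim: W w' => {i j w} [i j w e W IH|i j w ne lt W IH|i j ne le] w' W';
  inversion W' as [i' j' w1 h1 h2|i' j' w1 h1 h2 h3|i' j' h1 h2]; subst;
  rewrite ?(IH w1) //; exfalso; lia.
Qed.

End Shape.

(** * Choices of a path at the diagonal, and degenerate carries *)

(** Makes the alternatives of [crossing] exhaustive. If [P m.+1] is below the min of its neighbours,
    the load [C m] is positive, so [Q m] can stay at [nu m.+1] only when [P m] caps it. If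
    [nu m.+1 < Q m] and [P m.+1 = mu m.+1], the load is again positive and [Q m.+1] must have been
    filled up to [mu m.+1]. *)
Lemma carry_choice mu nu Q P C a n m :
    interlacing mu nu Q P -> carry_rule mu nu Q P C a n ->
  [/\ Q m.+1 = mu m.+1 -> P m.+1 = mu m.+1,
      Q m.+1 < mu m.+1 -> nu m.+1 = Q m -> P m.+1 < mu m.+1 ->
        0 < m /\ P m = nu m.+1
    & Q m.+1 < mu m.+1 -> nu m.+1 < Q m ->
        P m.+1 < mu m.+1 /\ (0 < m -> nu m.+1 < P m)].
Proof.
move=> I [R0 RQ RC _]; move: (I m) (RQ m) (RC m).
by case: m => [|m] h1 h2 h3; [|move: (RQ m) => h4]; split; lia.
Qed.

Lemma interlacing_ext mu nu Q P mu' nu' Q' P' :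
    (forall t, mu t.+1 = mu' t.+1) -> (forall t, nu t.+1 = nu' t.+1) ->
    Q =1 Q' -> (forall t, P t.+1 = P' t.+1) ->
  interlacing mu nu Q P -> interlacing mu' nu' Q' P'.
Proof. by move=> e1 e2 e3 e4 I t; rewrite -!e1 -!e2 -!e3 -!e4. Qed.

Lemma carry_rule_ext mu nu Q P mu' nu' Q' P' C a n :
    (forall t, mu t.+1 = mu' t.+1) -> (forall t, nu t.+1 = nu' t.+1) ->
    Q =1 Q' -> (forall t, P t.+1 = P' t.+1) ->
  carry_rule mu nu Q P C a n -> carry_rule mu' nu' Q' P' C a n.
Proof.
move=> e1 e2 e3 e4 [R0 RQ RC Ra].
by split=> // [|t|t]; rewrite -?e1 -?e2 -?e3 -?e4.
Qed.

Lemma crossing_ext mu nu Q P mu' nu' Q' P' m l p k :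
    (forall t, mu t.+1 = mu' t.+1) -> (forall t, nu t.+1 = nu' t.+1) ->
    Q =1 Q' -> (forall t, P t.+1 = P' t.+1) ->
  crossing mu nu Q P m l p k -> crossing mu' nu' Q' P' m l p k.
Proof.
move=> e1 e2 e3 e4; rewrite /crossing -!e1 -!e2 -!e3 -!e4.
case: m => [|m]; rewrite -?e4 // => -[X|[? ? ? [? ? ? _]]|[? [X|X|[_ _ _ [_]]]]] //.
- by constructor 1.
- by constructor 2.
- by constructor 3; split=> //; constructor 1.
- by constructor 3; split=> //; constructor 2.
Qed.

(** The situation when all columns left of the corner are empty: nothing absorbs the load, which
    reaches the corner as [a]. *)
Lemma carry_rule_flat mu nu Q P a n :
    (forall t, [/\ mu t.+1 = 0, nu t.+2 = 0, Q t.+1 = 0 & P t.+1 = 0]) ->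
  (exists C, carry_rule mu nu Q P C a n) <-> Q 0 = nu 1 + a.
Proof.
move=> z; split=> [[C [R0 RQ RC Ra]]|e].
  have Ca t : C 0 = C t.
    by elim: t => // t ->; have [? ? ? ?] := z t; have [? _ _ _] := z t.+1;
      move: (RC t); lia.
  by rewrite R0 (Ca n) Ra //; have [-> _ _ _] := z 0; rewrite max0n.
exists (fun=> a); split=> // [|t|t].
- by have [-> _ _ _] := z 0; rewrite max0n.
- by have [? ? ? ?] := z t; have [? _ _ _] := z t.+1; lia.
- by have [? ? ? ?] := z t; have [? _ _ _] := z t.+1; lia.
Qed.

Definition shrink (D : nat -> nat) n i := if i == n then (D n).-1 else D i.

Section Corner.
Variables (D : nat -> nat) (n : nat).
Hypothesis (Dmono : forall i, 0 < i -> D i.+1 <= D i).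
Hypothesis (n0 : 0 < n) (Dn : 0 < D n) (Dn1 : D n.+1 = 0).
Local Notation q := (D n).
Local Notation D' := (shrink D n).

Lemma shrink_mono i : 0 < i -> D' i.+1 <= D' i.
Proof.
rewrite /shrink => i0; have := Dmono i0.
by do 2 case: eqP => //; move=> *; subst; lia.
Qed.

Lemma rows_bound i : n < i -> D i = 0.
Proof. by move=> ni; apply/eqP; rewrite -leqn0 -Dn1 shape_le. Qed.

Lemma in_shape_row i j : in_shape D i j -> i <= n.
Proof.
by rewrite leqNgt; apply: contraL => /rows_bound h; rewrite /in_shape h; lia.
Qed.

Lemma in_shapeP i j : 0 < i <= n -> 0 < j <= q -> in_shape D i j.
Proof.
move=> hi hj; apply: (@in_shape_le D Dmono i j n q) => //.
by rewrite /in_shape n0 Dn /=.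
Qed.

Lemma in_shrink i j : in_shape D' i j = in_shape D i j && ((i, j) != (n, q)).
Proof.
rewrite /in_shape /shrink xpair_eqE; case: (eqVneq i n) => [->|]; last by rewrite andbT.
by case: eqP; lia.
Qed.

(** Truncated subtraction pads these sequences with zeros, since far indices land on row 0 or column
    0. Inside the shape, [below f t.+1] and [above f t.+1] are the west and north neighbours of
    [diag f t], while [below f t] and [above f t] are its south and east neighbours. *)
Definition diag (f : nat -> nat -> nat) t := f (n - t) (q - t).
Definition below (f : nat -> nat -> nat) t := f (n.+1 - t) (q - t).
Definition above (f : nat -> nat -> nat) t := f (n - t) (q.+1 - t).

(* g is the filling of the shape without its corner (n, q) on which the
   Hillman--Grassl map does what it does to f off the corner, and a is the
   multiplicity that f gives to the corner. *)
Definition related (f g : nat -> nat -> nat) (a : nat) : Prop :=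
  [/\ rpp_on D f, rpp_on D' g,
      forall i j, i + q != j + n -> f i j = g i j
    & exists C, carry_rule (below f) (above f) (diag f) (diag g) C a n].

Lemma off_diag f g : (forall i j, i + q != j + n -> f i j = g i j) ->
    rpp_on D f -> rpp_on D' g ->
  (forall t, below g t.+1 = below f t.+1) /\
  (forall t, above g t.+1 = above f t.+1).
Proof.
move=> e fP gP; split=> t; rewrite /below /above.
- have [h|h] := leqP n t;
    first by rewrite (_ : n.+1 - t.+1 = 0) ?(rpp_row0 fP) ?(rpp_row0 gP) //; lia.
  have [h'|h'] := leqP q t.+1;
    first by rewrite (_ : q - t.+1 = 0) ?(rpp_col0 fP) ?(rpp_col0 gP) //; lia.
  by rewrite e //; lia.
- have [h|h] := leqP n t.+1;
    first by rewrite (_ : n - t.+1 = 0) ?(rpp_row0 fP) ?(rpp_row0 gP) //; lia.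
  have [h'|h'] := leqP q t;
    first by rewrite (_ : q.+1 - t.+1 = 0) ?(rpp_col0 fP) ?(rpp_col0 gP) //; lia.
  by rewrite e //; lia.
Qed.

Lemma rpp_edge (E : nat -> nat) (h : nat -> nat -> nat) i j : rpp_on E h ->
  (0 < i -> 0 < j -> in_shape E i j) -> h i.-1 j <= h i j /\ h i j.-1 <= h i j.
Proof.
move=> hP hij; have [->|i0] := posnP i; first by rewrite !(rpp_row0 hP).
have [->|j0] := posnP j; first by rewrite !(rpp_col0 hP).
by split; [apply: (rpp_north hP)|apply: (rpp_west hP)]; apply: hij.
Qed.

Let s1 i : n.+1 - i.+1 = n - i. Proof. by lia. Qed.
Let s2 i : q.+1 - i.+1 = q - i. Proof. by lia. Qed.
Let p1 i : n - i.+1 = (n - i).-1. Proof. by lia. Qed.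
Let p2 i : q - i.+1 = (q - i).-1. Proof. by lia. Qed.

Lemma interlacing_diag f t : rpp_on D f ->
  below f t.+1 <= diag f t /\ above f t.+1 <= diag f t /\
  diag f t.+1 <= below f t.+1 /\ diag f t.+1 <= above f t.+1.
Proof.
move=> fP; rewrite /below /above /diag !s1 !s2.
have inD i j : i <= n -> j <= q -> 0 < i -> 0 < j -> in_shape D i j.
  by move=> *; apply: in_shapeP; apply/andP.
have [] := rpp_edge fP (@inD (n - t) (q - t) (leq_subr _ _) (leq_subr _ _)).
rewrite -p1 -p2 => -> ->; split=> //; split=> //.
have [h1 _] := rpp_edge fP (@inD (n - t) (q - t.+1) (leq_subr _ _) (leq_subr _ _)).
have [_ h2] := rpp_edge fP (@inD (n - t.+1) (q - t) (leq_subr _ _) (leq_subr _ _)).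
by rewrite -?p1 -?p2 in h1 h2.
Qed.

Lemma interlacing_diag_shrink g t : rpp_on D' g ->
  diag g t.+1 <= below g t.+1 /\ diag g t.+1 <= above g t.+1 /\
  below g t.+2 <= diag g t.+1 /\ above g t.+2 <= diag g t.+1.
Proof.
move=> gP; rewrite /below /above /diag !s1 !s2.
have inD i j : i <= n -> j <= q -> (i < n) || (j < q) -> 0 < i -> 0 < j -> in_shape D' i j.
  move=> hi hj h i0 j0; rewrite in_shrink in_shapeP ?i0 ?j0 //=.
  by rewrite xpair_eqE; lia.
have qt : (n - t < n) || (q - t.+1 < q) by lia.
have nt : (n - t.+1 < n) || (q - t < q) by lia.
have ntqt : (n - t.+1 < n) || (q - t.+1 < q) by lia.
have [h1 _] := rpp_edge gP (@inD (n - t) (q - t.+1) (leq_subr _ _) (leq_subr _ _) qt).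
have [_ h2] := rpp_edge gP (@inD (n - t.+1) (q - t) (leq_subr _ _) (leq_subr _ _) nt).
have [h3 h4] := rpp_edge gP (@inD (n - t.+1) (q - t.+1) (leq_subr _ _) (leq_subr _ _) ntqt).
by rewrite -?p1 -?p2 in h1 h2 h3 h4.
Qed.

Lemma interlacing_related f g : rpp_on D f -> rpp_on D' g ->
   (forall i j, i + q != j + n -> f i j = g i j) ->
  interlacing (below f) (above f) (diag f) (diag g).
Proof.
move=> fP gP e t; have [eb ea] := off_diag e fP gP.
by split; [exact: interlacing_diag|rewrite -!ea -!eb; exact: interlacing_diag_shrink].
Qed.

(** * Simulation of a path in the smaller shape *)

Section Simulation.
Variables f g : nat -> nat -> nat.
Hypotheses (fP : rpp_on D f) (gP : rpp_on D' g).
Hypothesis fg : forall i j, i + q != j + n -> f i j = g i j.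

(** Contents only grow along a walk, so from above the diagonal it never returns to the cells where
    [f] and [g] differ; nor does it meet row [n], the only row whose length changes. *)
Lemma walk_above i j w : walk D f i j w -> 0 < f i j -> i + q < j + n ->
  walk D' g i j w.
Proof.
have sh i' j' : in_shape D i' j' -> i' + q < j' + n -> D' i' = D i'.
  rewrite /shrink => /and3P[_ _]; case: eqP => // ->; lia.
move=> W; elim: W => {i j w} [i j w e W IH|i j w ne lt W IH|i j ne le] fij h.
- apply: walk_north; first by rewrite -!fg //; lia.
  by apply: IH; rewrite ?(eqP e) //; lia.
- have ij := rpp_gt0 fP fij; have /and3P[i0 j0 _] := ij.
  apply: walk_east; first by rewrite -!fg //; lia.
    by rewrite (sh i j).
  apply: IH; last by lia.
  by apply: leq_trans fij (rpp_le Dmono fP _ _ _) => //; rewrite /in_shape i0.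
- have ij := rpp_gt0 fP fij; have /and3P[i0 j0 _] := ij.
  by apply: walk_stop; [rewrite -!fg //; lia|rewrite (sh i j)].
Qed.

Variables (C : nat -> nat) (a : nat).
Hypothesis R : carry_rule (below f) (above f) (diag f) (diag g) C a n.

(** Describes both walks by indicator functions on the three diagonals concerned; in this form
    subtracting a walk is undone by [incr]. *)
Definition cross_data i j w w' m l p k : Prop :=
  [/\ crossing (below f) (above f) (diag f) (diag g) m l p k,
      (last (i, j) w).1 = (last (i, j) w').1,
      forall x y, x + q != y + n -> ((x, y) \in w) = ((x, y) \in w'),
      (forall t, ((n.+1 - t, q - t) \in w) = (t == m.+1)) /\
      (forall t, ((n - t, q - t) \in w) = (t == l))
    & (forall t, ((n - t.+1, q - t.+1) \in w') = (t.+1 == p)) /\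
      (forall t, ((n - t.+1, q.+1 - t.+1) \in w) = (t.+1 == k))].

Lemma cross_data_cons i j i1 j1 w w' m l p k :
    0 < i -> 0 < j -> j + n + 1 < i + q ->
    last (i1, j1) w = last (i, j) w -> last (i1, j1) w' = last (i, j) w' ->
  cross_data i1 j1 w w' m l p k ->
  cross_data i j ((i, j) :: w) ((i, j) :: w') m l p k.
Proof.
move=> i0 j0 h e e' [X lw off [h1 h2] [h3 h4]].
split=> //=; first by rewrite -e -e'.
- by move=> x y xy; rewrite !inE off.
- by split=> t; rewrite inE ?h1 ?h2 xpair_eqE; case: eqP; case: eqP; lia.
- by split=> t; rewrite inE ?h3 ?h4 xpair_eqE; case: eqP; case: eqP; lia.
Qed.

(** Both walks leave [u], visit one diagonal cell each and merge again into the common continuation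
    [w]. *)
Lemma cross_data_walk m l p k w :
    let u := (n - m, q - m.+1) in
    m < n -> m.+1 < q -> m <= l <= m.+1 -> m <= p <= m.+1 ->
    l <= k -> p <= k -> 0 < p -> 0 < k ->
    walk D f (n - k) (q.+1 - k) w -> 0 < f (n - k) (q.+1 - k) ->
    crossing (below f) (above f) (diag f) (diag g) m l p k ->
  cross_data u.1 u.2 (u :: (n - l, q - l) :: w) (u :: (n - p, q - p) :: w) m l p k.
Proof.
move=> u mn mq hl hp lk pk p0 k0 W fk X.
have nk : k < n by rewrite ltnNge; apply/negP => h; move: fk;
   rewrite (_ : n - k = 0) ?(rpp_row0 fP) //; lia.
have qk : k <= q by rewrite leqNgt; apply/negP => h; move: fk;
   rewrite (_ : q.+1 - k = 0) ?(rpp_col0 fP) //; lia.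
have wP x y : (x, y) \in w -> [/\ 0 < x, 0 < y, x + q < y + n &
   (x, y) = (n - k, q.+1 - k) \/ x + q + 1 < y + n].
  move=> m'; have [fxy _ _ h] := walk_mem Dmono fP W fk m'.
  have /and3P[x0 y0 _] := rpp_gt0 fP fxy.
  by case: h => [[ex ey]|h]; split=> //; [lia|left; rewrite ex ey|lia|right; lia].
have wN x y : [|| x == 0, y == 0 | y + n <= x + q] -> (x, y) \in w = false.
  by move=> h; apply/negP => /wP [? ? ? _]; lia.
have xp (x y x' y' : nat) : ((x, y) == (x', y')) = (x == x') && (y == y') by [].
split=> //=.
- by rewrite (last_walk _ (n - p, q - p) W).
- by move=> x y xy; rewrite !inE !xp; congr (_ || _);
    case: (_ \in w); rewrite ?orbT // !orbF; lia.
- split=> t; rewrite !inE !xp /=.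
    by rewrite wN; lia.
  by rewrite wN; lia.
- split=> t; rewrite !inE !xp /=.
    by rewrite wN; lia.
  have [e|ne] := eqVneq t.+1 k.
    by rewrite -e in W *; rewrite (walk_head W) !orbT.
  have -> : (n - t.+1, q.+1 - t.+1) \in w = false.
    by apply/negP => /wP [? ? _ [[]|]]; lia.
  lia.
Qed.

(** Below the diagonal the walk is copied, above it [walk_above] applies. Only the cell on the
    diagonal may change, and [carry_choice] tells how the smaller filling passes it. *)
Lemma walk_cross i j w : walk D f i j w -> 0 < f i j -> j + n < i + q ->
  exists w' m l p k, walk D' g i j w' /\ cross_data i j w w' m l p k.
Proof.
have I := interlacing_related fP gP fg.
move=> W; elim: W => {i j w} [i j w e W IH|i j w ne lt W IH|i j ne le] fij hij.
all: have ij := rpp_gt0 fP fij; have ile := in_shape_row ij; have /and3P[i0 j0 jD] := ij.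
all: have qD : q <= D i by exact: shape_le.
1: have [lo|hi] := ltnP (j + n).+1 (i + q).
3: have fE : 0 < f i j.+1 by
  apply: leq_trans fij (rpp_le Dmono fP _ _ _) => //; rewrite /in_shape i0.
3: have [lo|hi] := ltnP (j + n).+1 (i + q).
{ have [|| w' [m [l [p [k [W' X]]]]]] := IH; [by rewrite (eqP e)|by lia|].
  exists ((i, j) :: w'), m, l, p, k; split.
    by apply: walk_north => //; rewrite -!fg //; lia.
  by apply: cross_data_cons X => //; [lia|
    exact: (last_walk _ _ W)|exact: (last_walk _ _ W')]. }
{ pose m := n - i; have mn : m < n by lia.
  have ei : i = n - m by lia.
  have ej : j = q - m.+1 by lia.
  have [ch1 _ _] := carry_choice m I R.
  have B : below f m.+1 = f i j by rewrite /below; congr (f _ _); lia.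
  have Q1 : diag f m.+1 = f i.-1 j by rewrite /diag; congr (f _ _); lia.
  have P1 : diag g m.+1 = g i.-1 j by rewrite /diag; congr (g _ _); lia.
  have A1 : above f m.+1 = f i.-1 j.+1 by rewrite /above; congr (f _ _); lia.
  have A2 : above f m.+2 = f i.-2 j by rewrite /above; congr (f _ _); lia.
  have eQ : diag f m.+1 = below f m.+1 by rewrite Q1 B (eqP e).
  have eP := ch1 eQ.
  have gij : g i j = f i j by rewrite fg //; lia.
  have gN : g i.-1 j == g i j by rewrite -P1 eP B gij.
  have fN : 0 < f i.-1 j by rewrite (eqP e).
  have i1 : 0 < i.-1 by have /andP[] := rpp_gt0 fP fN.
  have g2 : g i.-2 j = f i.-2 j by rewrite fg //; lia.
  inversion W as [i' j' w2 e2 W2|i' j' w2 ne2 lt2 W2|i' j' ne2 le2]; subst i' j' w.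
  - have f2 : 0 < f i.-2 j by rewrite (eqP e2).
    have W2' := walk_above W2 f2.
    exists ((i, j) :: (i.-1, j) :: w2), m, m.+1, m.+1, m.+2; split.
      apply: walk_north => //; apply: walk_north; last by apply: W2'; lia.
      by rewrite g2 (eqP gN) gij (eqP e2) (eqP e).
    have -> : (i.-1, j) = (n - m.+1, q - m.+1) by congr (_, _); lia.
    rewrite ei ej; apply: cross_data_walk => //; try lia.
    + by rewrite (_ : n - m.+2 = i.-2) 1?(_ : q.+1 - m.+2 = j) //; lia.
    + by rewrite (_ : n - m.+2 = i.-2) 1?(_ : q.+1 - m.+2 = j) //; lia.
    by constructor 1; split=> //; split=> //; rewrite A2 B (eqP e2) (eqP e).
  - have f2 : 0 < f i.-1 j.+1.
      apply: leq_trans fN (rpp_le Dmono fP _ _ _) => //.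
      by rewrite /in_shape i1.
    have W2' := walk_above W2 f2.
    exists ((i, j) :: (i.-1, j) :: w2), m, m.+1, m.+1, m.+1; split.
      apply: walk_north => //; apply: walk_east; last by apply: W2'; lia.
        by rewrite g2 (eqP gN) gij -(eqP e).
      by rewrite /shrink; case: eqP => ?; lia.
    have -> : (i.-1, j) = (n - m.+1, q - m.+1) by congr (_, _); lia.
    rewrite ei ej; apply: cross_data_walk => //; try lia.
    + by rewrite (_ : n - m.+1 = i.-1) 1?(_ : q.+1 - m.+1 = j.+1) //; lia.
    + by rewrite (_ : n - m.+1 = i.-1) 1?(_ : q.+1 - m.+1 = j.+1) //; lia.
    by constructor 3; split=> //; constructor 1.
  (* Stopping here is impossible: row [i.-1] is at least as long as row [n], hence extends beyond
     column [j]. *)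
  have D2 : q <= D i.-1 by apply: (shape_le Dmono i1); lia.
  lia. }
{ have [|| w' [m [l [p [k [W' X]]]]]] := IH; [by []|by lia|].
  exists ((i, j) :: w'), m, l, p, k; split.
    apply: walk_east => //; first by rewrite -!fg //; lia.
    by rewrite /shrink; case: eqP => ?; subst; lia.
  by apply: cross_data_cons X => //; [lia|
    exact: (last_walk _ _ W)|exact: (last_walk _ _ W')]. }
{ pose m := n - i; have mn : m < n by lia.
  have ei : i = n - m by lia.
  have ej : j = q - m.+1 by lia.
  have [ch1 ch2 ch3] := carry_choice m I R.
  have B : below f m.+1 = f i j by rewrite /below; congr (f _ _); lia.
  have Q1 : diag f m.+1 = f i.-1 j by rewrite /diag; congr (f _ _); lia.
  have P1 : diag g m.+1 = g i.-1 j by rewrite /diag; congr (g _ _); lia.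
  have Q0 : diag f m = f i j.+1 by rewrite /diag; congr (f _ _); lia.
  have P0 : diag g m = g i j.+1 by rewrite /diag; congr (g _ _); lia.
  have A1 : above f m.+1 = f i.-1 j.+1 by rewrite /above; congr (f _ _); lia.
  have A0 : above f m = f i j.+2 by rewrite /above; congr (f _ _); lia.
  have ltQ : diag f m.+1 < below f m.+1.
    by rewrite Q1 B ltn_neqAle ne (rpp_north fP).
  have gij : g i j = f i j by rewrite fg //; lia.
  have gA1 : g i.-1 j.+1 = f i.-1 j.+1 by rewrite fg //; lia.
  have leP : diag g m.+1 <= below f m.+1 by case: (I m) => _; lia.
  have leA : above f m.+2 <= diag f m.+1 by case: (I m.+1); lia.
  have A2 : above f m.+2 = f i.-2 j by rewrite /above; congr (f _ _); lia.
  have shr : 0 < m -> D' i = D i by rewrite /shrink; case: eqP; lia.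
  inversion W as [i' j' w2 e2 W2|i' j' w2 ne2 lt2 W2|i' j' ne2 le2]; subst i' j' w.
  - have f2 : 0 < f i.-1 j.+1 by rewrite (eqP e2).
    have i1 : 0 < i.-1 by have /andP[] := rpp_gt0 fP f2.
    have W2' : walk D' g i.-1 j.+1 w2 by apply: walk_above; rewrite //; lia.
    have D2 : D i <= D i.-1 by apply: (shape_le Dmono i1); lia.
    have eQ : above f m.+1 = diag f m by rewrite A1 Q0 (eqP e2).
    have Wx : walk D f (n - m.+1) (q.+1 - m.+1) w2.
      by rewrite (_ : n - m.+1 = i.-1) 1?(_ : q.+1 - m.+1 = j.+1) //; lia.
    have fx : 0 < f (n - m.+1) (q.+1 - m.+1) by rewrite -/(above f _) A1.
    have c0 : (i, j.+1) = (n - m, q - m) by congr (_, _); lia.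
    have c1 : (i.-1, j) = (n - m.+1, q - m.+1) by congr (_, _); lia.
    (* The only place where the two walks may separate: the large one goes east and then north, the
       small one may go north and then east. Both arrive at the same cell. *)
    have [eP|neP] := eqVneq (diag g m.+1) (below f m.+1).
      exists ((i, j) :: (i.-1, j) :: w2), m, m, m.+1, m.+1; split.
        apply: walk_north; first by rewrite -P1 eP B gij.
        apply: walk_east W2'; last by rewrite /shrink; case: eqP => ?; lia.
        by rewrite -P1 -[g i.-2 j]fg; [rewrite -A2; lia|lia].
      rewrite c0 c1 ei ej; apply: cross_data_walk => //; try lia.
      by constructor 3; split=> //; constructor 2.
    have ltP : diag g m.+1 < below f m.+1 by rewrite ltn_neqAle neP.
    have [m0 eP] := ch2 ltQ eQ ltP.
    exists ((i, j) :: (i, j.+1) :: w2), m, m, m, m.+1; split.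
      apply: walk_east; first by rewrite -P1 gij -B.
        by rewrite shr.
      by apply: walk_north W2'; rewrite gA1 -P0 eP A1.
    rewrite c0 ei ej; apply: cross_data_walk => //; try lia.
    by constructor 3; split=> //; constructor 3.
  - have ltA : above f m.+1 < diag f m.
      rewrite A1 Q0 ltn_neqAle ne2; apply: (@rpp_north D f fP i j.+1).
      by rewrite /in_shape i0.
    have [ltP ltA'] := ch3 ltQ ltA.
    have m0 : 0 < m by rewrite lt0n; apply/negP => /eqP m0; move: lt2;
      rewrite (_ : i = n); lia.
    have f2 : 0 < f i j.+2.
      by apply: leq_trans fE (rpp_le Dmono fP _ _ _) => //; rewrite /in_shape i0.
    have W2' : walk D' g i j.+2 w2 by apply: walk_above; rewrite //; lia.
    exists ((i, j) :: (i, j.+1) :: w2), m, m, m, m; split.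
      apply: walk_east; first by rewrite -P1 gij -B; lia.
        by rewrite shr.
      apply: walk_east W2'; last by rewrite shr.
      by rewrite gA1 -P0 -A1; move: (ltA' m0); lia.
    have -> : (i, j.+1) = (n - m, q - m) by congr (_, _); lia.
    rewrite ei ej; apply: cross_data_walk => //; try lia.
    + by rewrite (_ : n - m = i) 1?(_ : q.+1 - m = j.+2) //; lia.
    + by rewrite (_ : n - m = i) 1?(_ : q.+1 - m = j.+2) //; lia.
    by constructor 2; split=> //; split=> //; lia.
  have ltA : above f m.+1 < diag f m.
    rewrite A1 Q0 ltn_neqAle ne2; apply: (@rpp_north D f fP i j.+1).
    by rewrite /in_shape i0.
  have [ltP _] := ch3 ltQ ltA.
  (* A walk can stop on the diagonal only at the corner; in the smaller shape it stops one cell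
     earlier, in the same row. *)
  have m0 : m = 0 by lia.
  have xp (x y x' y' : nat) : ((x, y) == (x', y')) = (x == x') && (y == y') by [].
  exists [:: (i, j)], 0, 0, 0, 0; split.
    by apply: walk_stop; [rewrite -P1 gij -B; lia|rewrite /shrink; case: eqP => ?; lia].
  split=> //=.
  - by constructor 2; rewrite -m0; split=> //; split=> //; lia.
  - by move=> x y xy; rewrite !inE !xp; clear - xy hij hi ile; lia.
  - by split=> t; rewrite !inE !xp; clear - hij hi i0 j0 m0 m ile; lia.
  - by split=> t; rewrite !inE !xp; clear - hij hi i0 j0 m0 m ile; lia. }
by clear - le hij qD ile; lia.
Qed.
End Simulation.

End Corner.

(** * Corner deletion commutes with the Hillman--Grassl map *)

Section Corner.
Variables (D : nat -> nat) (n : nat).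
Hypothesis (Dmono : forall i, 0 < i -> D i.+1 <= D i).
Hypothesis (n0 : 0 < n) (Dn : 0 < D n) (Dn1 : D n.+1 = 0).
Local Notation q := (D n).
Local Notation D' := (shrink D n).
Local Notation diag := (diag D n).
Local Notation below := (below D n).
Local Notation above := (above D n).
Local Notation related := (related D n).

Let shrunk_mono := shrink_mono Dmono n0 Dn Dn1.

Lemma sub_related f g b c w w' :
  rpp_on D f -> rpp_on D' g -> (forall i j, i + q != j + n -> f i j = g i j) ->
  (forall x y, y < c -> f x y = 0) -> (forall x y, y < c -> g x y = 0) ->
  0 < f b c -> 0 < g b c -> walk D f b c w -> walk D' g b c w' ->
  (forall x y, x + q != y + n -> ((x, y) \in w) = ((x, y) \in w')) ->
  [/\ rpp_on D (sub_walk f w), rpp_on D' (sub_walk g w') &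
   forall i j, i + q != j + n -> sub_walk f w i j = sub_walk g w' i j].
Proof.
move=> fP gP fg zf zg fbc gbc W W' ww'; split.
- exact: (rpp_sub_walk Dmono fP W).
- exact: (rpp_sub_walk shrunk_mono gP W').
- by move=> i j ij; rewrite /sub_walk fg // ww'.
Qed.

(** A diagonal entry of [g] is at most the entry just south of it, which lies in the same column and
    is shared with [f]. *)
Lemma related_zero f g a c : related f g a -> (forall x y, y < c -> f x y = 0) ->
  forall x y, y < c -> g x y = 0.
Proof.
case=> fP gP fg _ z x y yc.
have I := interlacing_related Dmono n0 Dn Dn1 fP gP fg.
have [e|ne] := eqVneq (x + q) (y + n); last by rewrite -fg // z.
have [//|gxy] := posnP (g x y).
have := rpp_gt0 gP gxy; rewrite in_shrink // => /andP[xy ne].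
have xn : x <= n by apply: in_shape_row xy.
have xlt : x < n.
  rewrite ltn_neqAle xn andbT; apply/eqP => xE; move/eqP: ne; apply.
  by congr (_, _); lia.
have [t et] : exists t, n - x = t.+1 by exists (n - x).-1; lia.
case: (I t) => _ [Pm _]; move: Pm.
have -> : diag g t.+1 = g x y by rewrite /diag; congr (g _ _); lia.
rewrite /below z; first by lia.
by lia.
Qed.

Lemma related_cross f g a c w : related f g a -> c < q -> 0 < f n c ->
    (forall x y, y < c -> f x y = 0) -> walk D f n c w ->
  exists w', [/\ walk D' g n c w', (last (n, c) w).1 = (last (n, c) w').1
    & related (sub_walk f w) (sub_walk g w') a].
Proof.
move=> rel cq fnc z W; have zg := related_zero rel z.
case: (rel) => fP gP fg [C R].
have gnc : 0 < g n c by rewrite -fg //; lia.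
have := walk_cross Dmono n0 Dn Dn1 fP gP fg R W fnc.
case=> [|w' [m [l [p [k [W' [X lw ww' [e1 e2] [e3 e4]]]]]]]]; first by lia.
exists w'; split=> //.
have [f1P g1P fg1] := sub_related fP gP fg z zg fnc gnc W W' ww'.
split=> //.
have fE x y := sub_walkK Dmono fP x y W fnc.
have gE x y := sub_walkK shrunk_mono gP x y W' gnc.
have E1 t : below f t.+1 = incr (below (sub_walk f w)) m.+1 t.+1.
  by rewrite /below fE e1.
have E2 t : above f t.+1 = incr (above (sub_walk f w)) k t.+1.
  by rewrite /above fE e4.
have E3 : diag f =1 incr (diag (sub_walk f w)) l.
  by move=> t; rewrite /diag fE e2.
have E4 t : diag g t.+1 = incr (diag (sub_walk g w')) p t.+1.
  by rewrite /diag gE e3.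
have I := interlacing_related Dmono n0 Dn Dn1 fP gP fg.
(* The new carry sequence is the [carry_step] of the old one at this crossing. *)
eexists; apply: carry_rule_decr.
- exact: (interlacing_related Dmono n0 Dn Dn1 f1P g1P fg1).
- exact: interlacing_ext E1 E2 E3 E4 I.
- exact: carry_rule_ext E1 E2 E3 E4 R.
- case=> [|t nt]; first by lia.
  by rewrite -E2 /above (_ : n - t.+1 = 0) ?(rpp_row0 fP) //; lia.
- exact: crossing_ext E1 E2 E3 E4 X.
Qed.

Lemma related_flat f g a : related f g a -> (forall x y, y < q -> f x y = 0) ->
  forall t, [/\ below f t.+1 = 0, above f t.+2 = 0, diag f t.+1 = 0 & diag g t.+1 = 0].
Proof.
move=> rel z t; have zg := related_zero rel z.
by rewrite /below /above /diag !z ?zg //; lia.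
Qed.

(** With the columns left of q empty, the rule reads f n q = f n.-1 q + a. If a is positive, the
    path cannot go north and stops at once, using up one unit of a. If a = 0, it goes north and
    continues as the path of [g], whose column q ends in row n - 1. *)
Lemma related_corner f g a w : related f g a -> 0 < f n q ->
    (forall x y, y < q -> f x y = 0) -> walk D f n q w ->
  (w = [:: (n, q)] /\ exists2 a', a = a'.+1 & related (sub_walk f w) g a') \/
  exists w', [/\ 0 < g n.-1 q, walk D' g n.-1 q w',
    (last (n, q) w).1 = (last (n.-1, q) w').1, (last (n, q) w).1 < n
    & related (sub_walk f w) (sub_walk g w') a].
Proof.
move=> rel fnq z W; have zg := related_zero rel z.
have flat := related_flat rel z.
case: (rel) => fP gP fg R.
have := R; rewrite carry_rule_flat // => e.
have e0 : f n q = f n.-1 q + a.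
  by move: e; rewrite /diag /above !subn0 !subn1.
have f1P := rpp_sub_walk Dmono fP W fnq z.
inversion W as [i' j' w2 e2 W2|i' j' w2 ne2 lt2 W2|i' j' ne2 le2]; subst i' j' w.
- have f1 : 0 < f n.-1 q by rewrite (eqP e2).
  have g1 : 0 < g n.-1 q by rewrite -fg //; lia.
  have W' : walk D' g n.-1 q w2.
    by apply: (walk_above Dmono n0 Dn Dn1 fP fg W2) => //; lia.
  right; exists w2; have [lo _ _] := walk_size Dmono fP W2 f1.
  split=> //.
  + by rewrite /= (last_walk (n, q) (n.-1, q) W2).
  + by rewrite /= (last_walk (n, q) (n.-1, q) W2); lia.
  have g1P := rpp_sub_walk shrunk_mono gP W' g1 zg.
  split=> //.
    move=> i j ij; rewrite /sub_walk fg // inE xpair_eqE; congr (_ - _).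
    by case: (i =P n) ij => [->|_] //; case: (j =P q) => [->|_] //; rewrite addnC eqxx.
  apply/carry_rule_flat.
    by move=> t; rewrite /above /below /diag /sub_walk !z ?zg ?sub0n //; lia.
  rewrite /above /diag !subn0 !subn1 /sub_walk /= mem_head.
  by rewrite inE (walk_head W2) orbT e0; lia.
- by lia.
- left; split=> //; exists a.-1; first by move/eqP: ne2; lia.
  split=> //.
    move=> i j ij; rewrite /sub_walk fg // inE xpair_eqE.
    case: (i =P n) ij => [->|_] ij; last by rewrite subn0.
    by case: (j =P q) ij => [->|_] ij; [rewrite addnC eqxx in ij|rewrite subn0].
  apply/carry_rule_flat.
    by move=> t; rewrite /above /below /diag /sub_walk !z ?zg ?sub0n //; lia.
  rewrite /above /diag !subn0 !subn1 /sub_walk /= mem_head !inE xpair_eqE.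
  by rewrite (_ : n.-1 == n = false); move/eqP: ne2; lia.
Qed.

(** A path of [f] contributing to the corner has no counterpart for [g]; every other path has one
    with the same starting column and the same final row. *)
Lemma hg_related f A : hg D f A -> forall g a, related f g a ->
  hg D' g (fun i j => if (i, j) == (n, q) then 0 else A i j) /\ A n q = a.
Proof.
elim=> {f A} [f A f0 A0|f A B b c w fbc bc z W _ IH AB] g a rel.
  have g0 i j : g i j = 0 by apply: (related_zero (c := j.+1) rel).
  have flat := related_flat rel (fun x y _ => f0 x y).
  case: rel => _ _ _; rewrite carry_rule_flat // /diag /above !f0 => a0.
  by split; [apply: hg_zero => // i j; rewrite A0 if_same|rewrite A0].
have zg := related_zero rel z.
case: (rel) => fP gP fg R.
have bcS := rpp_gt0 fP fbc; have /and3P[b0 c0 cD] := bcS.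
have bn : b <= n := in_shape_row Dmono n0 Dn Dn1 bcS.
(* The common conclusion for a step that both fillings take and that does not contribute to the
   corner. *)
have Bcase w' g1 b' : walk D' g b' c w' -> 0 < g b' c -> ~~ in_shape D' b'.+1 c ->
   (last (b, c) w).1 = (last (b', c) w').1 -> (last (b, c) w).1 != n \/ c != q ->
   g1 = sub_walk g w' -> related (sub_walk f w) g1 a ->
  hg D' g (fun i j => if (i, j) == (n, q) then 0 else A i j) /\ A n q = a.
  move=> W' gb' b'c lw cn -> /IH [H1 H2]; split; last first.
    by rewrite AB H2; case: cn; lia.
  apply: (hg_cons gb' b'c zg W' H1) => i j; rewrite xpair_eqE -lw AB.
  by case: (i =P n) => [->|_]; case: (j =P q) => [->|_] //=; case: cn; lia.
have [cq|qc|ecq] := ltngtP c q.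
- have bn' : b = n.
    apply/eqP; rewrite eqn_leq bn leqNgt; apply/negP => h; move: bc.
    by rewrite /in_shape c0 /= (leq_trans (ltnW cq)) // shape_le.
  subst b; have [w' [W' lw rel']] := related_cross rel cq fbc z W.
  apply: (Bcase w' _ n W') => //; last by right; lia.
    by rewrite -fg //; lia.
  by rewrite /in_shape /shrink; case: eqP; rewrite ?Dn1; lia.
- have bn' : b < n.
    rewrite ltn_neqAle bn andbT; apply/eqP => h; subst b; lia.
  have W' : walk D' g b c w by apply: (walk_above Dmono n0 Dn Dn1 fP fg W) => //; lia.
  have gbc : 0 < g b c by rewrite -fg //; lia.
  apply: (Bcase w _ b W') => //; last 2 first.
  + by right; lia.
  + have [f1P g1P fg1] := sub_related fP gP fg z zg fbc gbc W W' (fun _ _ _ => erefl).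
    split=> //.
    have ww x y : y <= q -> sub_walk f w x y = f x y.
      move=> yq; rewrite /sub_walk; case: (boolP ((x, y) \in w)); last by rewrite subn0.
      by case/(walk_mem Dmono fP W fbc); lia.
    have ww' x y : y <= q -> sub_walk g w x y = g x y.
      move=> yq; rewrite /sub_walk; case: (boolP ((x, y) \in w)); last by rewrite subn0.
      by case/(walk_mem Dmono fP W fbc); lia.
    case: R => C R; exists C; apply: carry_rule_ext R => t;
    by rewrite /below /above /diag ?ww ?ww' //; lia.
  by rewrite in_shrink // (negPf bc).
- subst c; have bn' : b = n.
    apply/eqP; rewrite eqn_leq bn leqNgt; apply/negP => h; move: bc.
    by rewrite /in_shape Dn /= shape_le.
  subst b; have [[ew [a' ea rel']]|[w' [gb W' lw ln rel']]] := related_corner rel fbc z W.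
    have [H1 H2] := IH _ _ rel'; split; last first.
      by rewrite AB H2 ew /= !eqxx ea addn1.
    apply: hg_ext H1 => i j; rewrite AB ew xpair_eqE /=.
    by case: (i == n); case: (j == q); rewrite ?addn0.
  apply: (Bcase w' _ n.-1 W') => //; last by left; lia.
  by rewrite in_shrink // prednK // eqxx andbF.
Qed.

End Corner.

(** * Inverting the corner rule *)

Section Corner.
Variables (D : nat -> nat) (n : nat).
Hypothesis (Dmono : forall i, 0 < i -> D i.+1 <= D i).
Hypothesis (n0 : 0 < n) (Dn : 0 < D n) (Dn1 : D n.+1 = 0).
Local Notation q := (D n).
Local Notation D' := (shrink D n).
Local Notation diag := (diag D n).
Local Notation below := (below D n).
Local Notation above := (above D n).
Local Notation related := (related D n).
Let upper f t := maxn (below f t) (above f t).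
Let lower f t := minn (below f t) (above f t).


Lemma corner_in : in_shape D n q.
Proof. by rewrite /in_shape n0 Dn /=. Qed.

(** The test [i <= n] keeps the truncated index [n - i] from reading [s 0] below the corner. *)
Definition patch (h : nat -> nat -> nat) (s : nat -> nat) i j :=
  if i + q == j + n then if i <= n then s (n - i) else 0 else h i j.

Lemma patch_off h s i j : i + q != j + n -> patch h s i j = h i j.
Proof. by rewrite /patch => /negPf ->. Qed.

(** Serves deletion and insertion alike: [E0] is the shape at hand and [E] the shape wanted, each
    differing from [D] at most at the corner. *)
Lemma rpp_patch E E0 h s :
    (forall i j, (i, j) != (n, q) -> in_shape E i j = in_shape D i j) ->
    (forall i j, (i, j) != (n, q) -> in_shape E0 i j = in_shape D i j) ->
    rpp_on E0 h ->
    (forall t, (n <= t) || (q <= t) -> s t = 0) ->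
    (~~ in_shape E n q -> s 0 = 0) ->
    (forall t, s t.+1 <= lower h t.+1) ->
    (forall t, (0 < t) || in_shape E n q -> upper h t.+1 <= s t) ->
  rpp_on E (patch h s).
Proof.
move=> EE EE0 hP sz s0 sl su; case: (hP) => h0 hN hW.
have off i j : i + q != j + n -> (i, j) != (n, q).
  by apply: contraNneq => -[-> ->]; rewrite addnC.
have inDE i j : in_shape E i j -> in_shape D i j.
  by have [[-> ->] _|/EE ->] := eqVneq (i, j) (n, q); rewrite ?corner_in.
split=> i j ij; rewrite /patch.
- have [e|/off ne] := eqVneq (i + q) (j + n); last by rewrite h0 // EE0 // -EE.
  case: leqP => // ile; have [i0|i0] := posnP i; first by rewrite sz //; lia.
  have [j0|j0] := posnP j; first by rewrite sz //; lia.
  have := ij; have [[-> ->] nE|/EE ->] := eqVneq (i, j) (n, q).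
    by rewrite subnn s0.
  by rewrite (in_shapeP Dmono n0 Dn) //; lia.
- have ile := in_shape_row Dmono n0 Dn Dn1 (inDE _ _ ij).
  have := ij; rewrite {1}/in_shape => /and3P[_ j0 _].
  have [e|/off ne] := eqVneq (i + q) (j + n).
    rewrite (_ : i.+1 + q == j + n = false) ?(ltnW ile); last by lia.
    rewrite (_ : n - i = (n - i.+1).+1); last by lia.
    apply: leq_trans (sl _) _; rewrite /lower geq_min /below; apply/orP; left.
    by rewrite (_ : n.+1 - _ = i.+1) 1?(_ : q - _ = j) //; lia.
  have [e|/off ne'] := eqVneq (i.+1 + q) (j + n).
    rewrite ile; apply: leq_trans (su _ _).
      rewrite /upper leq_max /above; apply/orP; right.
      by rewrite (_ : n - _ = i) 1?(_ : q.+1 - _ = j) //; lia.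
    have [t0|//] := posnP (n - i.+1).
    have ei : i.+1 = n by lia.
    have ej : j = q by lia.
    by rewrite ei ej in ij.
  by apply: hN; rewrite EE0 // -EE.
- have ile := in_shape_row Dmono n0 Dn Dn1 (inDE _ _ ij).
  have := inDE _ _ ij; rewrite /in_shape => /and3P[i0 _ jD].
  have [e|/off ne] := eqVneq (i + q) (j + n).
    rewrite (_ : i + q == j.+1 + n = false) ?ile; last by lia.
    have ni : i < n.
      rewrite ltn_neqAle ile andbT; apply/eqP => ei; subst i; lia.
    rewrite (_ : n - i = (n - i.+1).+1); last by lia.
    apply: leq_trans (sl _) _; rewrite /lower geq_min /above; apply/orP; right.
    by rewrite (_ : n - _ = i) 1?(_ : q.+1 - _ = j.+1) //; lia.
  have [e|/off ne'] := eqVneq (i + q) (j.+1 + n).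
    rewrite ile; apply: leq_trans (su _ _).
      rewrite /upper leq_max /below; apply/orP; left.
      by rewrite (_ : n.+1 - _ = i) 1?(_ : q - _ = j) //; lia.
    have [t0|//] := posnP (n - i).
    have ei : i = n by lia.
    have ej : j.+1 = q by lia.
    by rewrite ei ej in ij.
  by apply: hW; rewrite EE0 // -EE.
Qed.

(* The carry rule solved for P and C, starting from the corner. *)
Fixpoint carry_up f t :=
  if t is t'.+1 then
    let c := carry_up f t' in
    c + diag f t + maxn (diag f t) (lower f t - c) - (upper f t.+1 + lower f t)
  else diag f 0 - upper f 1.

(** The value of P t: either Q t is filled up to P t, or the arriving load is exhausted and the load
    passed on is [lower f t] - P t. Only positive t matter. *)
Definition removed f t := maxn (diag f t) (lower f t - carry_up f t.-1).

Lemma removed_bounds f t : rpp_on D f -> upper f t.+2 <= removed f t.+1 <= lower f t.+1.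
Proof.
move=> fP; have := interlacing_diag Dmono n0 Dn Dn1 t fP.
have := interlacing_diag Dmono n0 Dn Dn1 t.+1 fP.
by rewrite /removed /upper /lower; lia.
Qed.


Lemma removed_out f t : rpp_on D f -> (n <= t) || (q <= t) -> 0 < t -> removed f t = 0.
Proof.
move=> fP; case: t => // t h _; have /andP[_] := removed_bounds t fP.
rewrite /lower /below /above; case/orP: h => h.
  by rewrite (_ : n - t.+1 = 0) ?(rpp_row0 fP); lia.
by rewrite (_ : q - t.+1 = 0) ?(rpp_col0 fP); lia.
Qed.

Lemma shrink_off i j : (i, j) != (n, q) -> in_shape D' i j = in_shape D i j.
Proof. by move=> h; rewrite in_shrink // h andbT. Qed.

Lemma corner_notin : in_shape D' n q = false.
Proof. by rewrite in_shrink // eqxx andbF. Qed.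

Lemma diag_patch h s t : rpp_on D (patch h s) \/ rpp_on D' (patch h s) ->
  ((n <= t) || (q <= t) -> s t = 0) -> diag (patch h s) t = s t.
Proof.
move=> hP st; rewrite /diag.
have z : (n <= t) || (q <= t) -> patch h s (n - t) (q - t) = 0.
  case/orP=> h'.
    rewrite (_ : n - t = 0); last by lia.
    by case: hP => hP; rewrite (rpp_row0 hP).
  rewrite (_ : q - t = 0); last by lia.
  by case: hP => hP; rewrite (rpp_col0 hP).
have [h'|h'] := boolP ((n <= t) || (q <= t)); first by rewrite z // st.
rewrite /patch (_ : _ + _ == _ = true); last by lia.
by rewrite leq_subr; congr s; lia.
Qed.

Lemma related_remove f : rpp_on D f -> exists g a, related f g a.
Proof.
move=> fP; pose s t := if t is _.+1 then removed f t else 0.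
have sz t : (n <= t) || (q <= t) -> s t = 0.
  by case: t => // t h; rewrite /s removed_out.
have gP : rpp_on D' (patch f s).
  apply: (@rpp_patch D' D) => //.
  - exact: shrink_off.
  - by move=> t; case/andP: (removed_bounds t fP).
  - by case=> [|t]; rewrite ?corner_notin // => _; case/andP: (removed_bounds t fP).
have fg i j : i + q != j + n -> f i j = patch f s i j by move=> h; rewrite patch_off.
exists (patch f s), (carry_up f n); split=> //; exists (carry_up f).
have dg t : diag (patch f s) t.+1 = removed f t.+1.
  by rewrite diag_patch //; [right|apply: sz].
have I t := interlacing_diag Dmono n0 Dn Dn1 t fP.
have ge t : upper f t.+2 + lower f t.+1 <= carry_up f t + diag f t.+1 + removed f t.+1.
  by move: (I t) (I t.+1); rewrite /removed /upper /lower /=; lia.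
split.
- by move: (I 0); rewrite /= /upper; lia.
- move=> t; rewrite dg; move: (ge t) (I t) (I t.+1); rewrite /= -/(removed f t.+1).
  by rewrite /removed /upper /lower /=; lia.
- move=> t; rewrite dg; move: (ge t); rewrite /= -/(removed f t.+1) /upper /lower; lia.
(* From index [n] on the sequences involved vanish and the carry is constant; this is why its value
   at [n] is the multiplicity. *)
- move=> t nt; rewrite -(subnK nt); elim: (t - n) => [//|d IH].
  rewrite addSn -[RHS]IH /=; set u := d + n.
  have z1 : diag f u.+1 = 0 by rewrite /diag (_ : n - u.+1 = 0) ?(rpp_row0 fP) //; lia.
  have z2 : above f u.+1 = 0
    by rewrite /above (_ : n - u.+1 = 0) ?(rpp_row0 fP) //; lia.
  have z3 : above f u.+2 = 0
    by rewrite /above (_ : n - u.+2 = 0) ?(rpp_row0 fP) //; lia.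
  have z4 : below f u.+2 = 0
    by rewrite /below (_ : n.+1 - u.+2 = 0) ?(rpp_row0 fP) //; lia.
  by rewrite /upper /lower z1 z2 z3 z4; lia.
Qed.

Section Insert.
Variables (g : nat -> nat -> nat) (a : nat).

(* The carry rule solved for Q and C, starting from the far end: carry_down k is
   the carry at distance n - k from the corner. *)
Fixpoint carry_down k :=
  if k is k'.+1 then
    let c := carry_down k' in let t := n - k' in
    c + upper g t.+1 + lower g t - minn (upper g t.+1 + c) (diag g t) - diag g t
  else a.

Definition inserted t :=
  let v := upper g t.+1 + carry_down (n - t) in
  if t is 0 then v else minn v (diag g t).

Lemma related_insert : rpp_on D' g -> exists f, related f g a.
Proof.
move=> gP; have I t := interlacing_diag_shrink Dmono n0 Dn Dn1 t gP.
have sl t : inserted t.+1 <= diag g t.+1 by exact: geq_minr.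
have sz t : (n <= t) || (q <= t) -> inserted t = 0.
  case: t => [|t] h; first by lia.
  apply/eqP; rewrite -leqn0; apply: leq_trans (sl _) _; rewrite /diag; case/orP: h => h.
    by rewrite (_ : n - t.+1 = 0) ?(rpp_row0 gP) //; lia.
  by rewrite (_ : q - t.+1 = 0) ?(rpp_col0 gP) //; lia.
have fP : rpp_on D (patch g inserted).
  apply: (@rpp_patch D D') => //.
  - exact: shrink_off.
  - by rewrite corner_in.
  - by move=> t; apply: leq_trans (sl t) _; move: (I t); rewrite /lower; lia.
  - by case=> [|t] _; rewrite /inserted /=; [|move: (I t)]; rewrite /upper; lia.
have fg i j : i + q != j + n -> patch g inserted i j = g i j by move=> h; rewrite patch_off.
have df t : diag (patch g inserted) t = inserted t.
  by apply: diag_patch; [left|apply: sz].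
have [eb ea] := off_diag n0 Dn Dn1 fg fP gP.
exists (patch g inserted); split=> //; exists (fun t => carry_down (n - t)); split.
- by rewrite df -eb -ea.
- by move=> t; rewrite df -eb -ea.
- move=> t; rewrite !df -!eb -!ea.
  (* Here [n - t] is truncated to 0, so both carries are [a] and the conservation law must hold
     between zeros. *)
  have [nt|nt] := leqP n t.
    have -> : n - t = 0 by lia.
    have -> : n - t.+1 = 0 by lia.
    rewrite sz; last by lia.
    have -> : diag g t.+1 = 0
      by rewrite /diag (_ : n - t.+1 = 0) ?(rpp_row0 gP) //; lia.
    have -> : above g t.+1 = 0
      by rewrite /above (_ : n - t.+1 = 0) ?(rpp_row0 gP) //; lia.
    have -> : above g t.+2 = 0
      by rewrite /above (_ : n - t.+2 = 0) ?(rpp_row0 gP) //; lia.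
    have -> : below g t.+2 = 0
      by rewrite /below (_ : n.+1 - t.+2 = 0) ?(rpp_row0 gP) //; lia.
    by lia.
  rewrite (_ : n - t = (n - t.+1).+1) /=; last by lia.
  rewrite (_ : n - (n - t.+1) = t.+1); last by lia.
  by rewrite /inserted; move: (I t); rewrite /upper /lower; lia.
- by move=> t nt; rewrite (_ : n - t = 0) //; lia.
Qed.
End Insert.

(** Read from the far end, where the load is [a], the rule determines the carry from [g] alone, and
    with it the diagonal of the larger filling. *)
Lemma related_inj f1 f2 g a : related f1 g a -> related f2 g a ->
  forall i j, f1 i j = f2 i j.
Proof.
move=> [f1P gP e1 [C1 [R10 R1Q R1C R1a]]] [f2P _ e2 [C2 [R20 R2Q R2C R2a]]].
have [b1 a1] := off_diag n0 Dn Dn1 e1 f1P gP.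
have [b2 a2] := off_diag n0 Dn Dn1 e2 f2P gP.
have eC t : C1 t = C2 t.
  have [nt|tn] := leqP n t; first by rewrite R1a ?R2a.
  rewrite -(subKn (ltnW tn)); elim: (n - t) => [|d IH]; first by rewrite subn0 R1a ?R2a.
  have [nd|dn] := leqP n d; first by rewrite (_ : n - d.+1 = n - d) //; lia.
  have ed : n - d = (n - d.+1).+1 by lia.
  move: (R1C (n - d.+1)) (R2C (n - d.+1)) (R1Q (n - d.+1)) (R2Q (n - d.+1)).
  by rewrite -!b1 -!b2 -!a1 -!a2 -ed IH; lia.
have eQ t : diag f1 t = diag f2 t.
  case: t => [|t]; first by rewrite R10 R20 -b1 -b2 -a1 -a2 eC.
  by rewrite R1Q R2Q -b1 -b2 -a1 -a2 eC.
move=> i j; have [e|ne] := eqVneq (i + q) (j + n); last by rewrite e1 ?e2.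
have [ile|ni] := leqP i n.
  by have := eQ (n - i); rewrite /diag (_ : n - _ = i) 1?(_ : q - _ = j) //; lia.
have o : ~~ in_shape D i j by apply/negP => /(in_shape_row Dmono n0 Dn Dn1); lia.
by case: f1P => -> // _ _; case: f2P => ->.
Qed.
End Corner.

(** * Existence, uniqueness and weight of the image *)

Section Total.
Variables (D : nat -> nat) (n : nat).
Hypothesis (Dmono : forall i, 0 < i -> D i.+1 <= D i).
Hypothesis (Dn1 : D n.+1 = 0).

Lemma rows_le i j : in_shape D i j -> i <= n.
Proof.
move=> /and3P[i0 j0 jD]; rewrite leqNgt; apply/negP => ni.
by move: (shape_le Dmono (ltn0Sn n) ni); rewrite Dn1; lia.
Qed.

Definition cells := [seq (i, j) | i <- iota 1 n, j <- iota 1 (D i)].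

Lemma mem_cells i j : ((i, j) \in cells) = in_shape D i j.
Proof.
apply/allpairsPdep/idP => [[x [y [hx hy [-> ->]]]]|ij].
  by move: hx hy; rewrite !mem_iota /in_shape; lia.
have ile := rows_le ij; move: ij => /and3P[i0 j0 jD].
by exists i, j; rewrite !mem_iota; split=> //; lia.
Qed.

Lemma uniq_cells : uniq cells.
Proof.
apply: allpairs_uniq_dep => [|i _|]; rewrite ?iota_uniq //.
by move=> [i1 j1] [i2 j2] /= _ _ [-> ->].
Qed.

Definition col_len j := count (fun i => j <= D i) (iota 1 n).
Definition hook_len i j := (D i - j) + (col_len j - i) + 1.

Lemma col_lenE b c : in_shape D b c -> ~~ in_shape D b.+1 c -> col_len c = b.
Proof.
move=> bc bc'; have bn := rows_le bc; rewrite /col_len -(subnKC bn) iotaD count_cat.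
rewrite (eq_in_count (a2 := predT)) ?count_predT ?size_iota.
  rewrite (eq_in_count (a2 := pred0)) ?count_pred0 ?addn0 // => i.
  rewrite mem_iota => hi; apply/negP => ci; move/negP: bc'; apply.
  have /and3P[b0 c0 _] := bc; rewrite /in_shape c0 (leq_trans ci) //.
  by apply: shape_le => //; lia.
move=> i; rewrite mem_iota => hi /=; have /and3P[b0 c0 cD] := bc.
by apply: leq_trans cD _; apply: shape_le => //; lia.
Qed.

Definition total (f : nat -> nat -> nat) := \sum_(u <- cells) f u.1 u.2.

Lemma sum_mem (T : eqType) (r w : seq T) : uniq r -> uniq w -> {subset w <= r} ->
  \sum_(u <- r) (u \in w) = size w.
Proof.
move=> ur uw wr; rewrite -sum1_size [RHS](perm_big [seq u <- r | u \in w]) /=.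
  by rewrite big_filter [RHS]big_mkcond; apply: eq_bigr => u _; case: (u \in w).
apply: uniq_perm; rewrite ?filter_uniq // => u; rewrite mem_filter.
by case: (boolP (u \in w)) => // /wr ->.
Qed.

Lemma total_sub f b c w : rpp_on D f -> walk D f b c w -> 0 < f b c ->
  total f = total (sub_walk f w) + size w.
Proof.
move=> fP W fbc; rewrite /total.
rewrite (eq_bigr (fun u => sub_walk f w u.1 u.2 + (u \in w))); last first.
  by case=> x y _; rewrite (sub_walkK Dmono fP x y W fbc).
rewrite big_split /=; congr (_ + _); rewrite sum_mem ?uniq_cells //.
  exact: (walk_uniq Dmono fP W).
case=> x y /(walk_mem Dmono fP W fbc) [fxy _ _ _].
by rewrite mem_cells (rpp_gt0 fP).
Qed.

Lemma hg_exists f : rpp_on D f -> exists A, hg D f A.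
Proof.
have [k] := ubnP (total f); elim: k f => // k IH f lek fP.
have [z|nz] := boolP (all (fun u => f u.1 u.2 == 0) cells).
  exists (fun _ _ => 0); apply: hg_zero => // i j.
  have [ij|ij] := boolP (in_shape D i j).
    by apply/eqP; apply: (allP z (i, j)); rewrite mem_cells.
  by case: fP => ->.
(* The least such column, together with the lowest row meeting it, gives the start of the next
   path. *)
have exc : exists c, has (fun u => (u.2 == c) && (0 < f u.1 u.2)) cells.
  move: nz; rewrite -has_predC => /hasP[[i j] ij /= fij]; exists j; apply/hasP.
  by exists (i, j); rewrite //= eqxx lt0n.
case: (ex_minnP exc) => c /hasP[[i j] ij /= /andP[/eqP ejc fic]] cmin; subst j.
rewrite mem_cells in ij.
have z x y : y < c -> f x y = 0.
  move=> yc; apply/eqP; rewrite -leqn0 leqNgt; apply/negP => fxy.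
  have := cmin y; rewrite leqNgt yc => h; apply: notF; apply: h; apply/hasP.
  by exists (x, y); rewrite ?mem_cells ?(rpp_gt0 fP) //= eqxx.
have exb : exists b, in_shape D b c by exists i.
case: (ex_maxnP exb (fun b => @rows_le b c)) => b bc bmax.
have fbc : 0 < f b c.
  by apply: leq_trans fic (rpp_le Dmono fP bc _ (leqnn _)); apply: bmax.
have bc' : ~~ in_shape D b.+1 c by apply/negP => /bmax; rewrite ltnn.
have [w W] := walk_exists Dmono fP fbc.
have f1P := rpp_sub_walk Dmono fP W fbc z.
have [|B H] := IH _ _ f1P.
  move: lek; rewrite (total_sub fP W fbc); move: (walk_head W); case: w {W f1P} => //= *; lia.
exists (fun i j => B i j + ((i == (last (b, c) w).1) && (j == c))).
exact: hg_cons W H _.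
Qed.

Lemma hg_det f A A' : rpp_on D f -> hg D f A -> hg D f A' -> forall i j, A i j = A' i j.
Proof.
clear Dn1 => fP H; elim: H fP A' => {f A} [f A f0 A0|f A B b c w fbc bc z W _ IH AB] fP A' H'.
  case: H' => [_ A0' i j|B b c w fbc]; first by rewrite A0 A0'.
  by rewrite f0 in fbc.
case: H' => [f0|B' b' c' w' fbc' bc' z' W' H' AB']; first by rewrite f0 in fbc.
have ec : c = c'.
  by have [cc|cc|//] := ltngtP c c'; [rewrite z' in fbc|rewrite z in fbc'].
subst c'; have bcS := rpp_gt0 fP fbc; have bcS' := rpp_gt0 fP fbc'.
have eb : b = b'.
  have lem x y : in_shape D x c -> ~~ in_shape D y.+1 c -> in_shape D y c -> x <= y.
    move=> h1 h2 h3; rewrite leqNgt; apply: contra h2 => yx.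
    have /and3P[_ c0 _] := h1.
    by apply: (in_shape_le Dmono h1); lia.
  by apply/eqP; rewrite eqn_leq !lem.
subst b'; have ew := walk_det W W'; subst w'.
have f1P := rpp_sub_walk Dmono fP W fbc z.
by move=> i j; rewrite AB AB' (IH f1P _ H').
Qed.

(** Each path removes as many units as it has cells, and by [walk_size] and [col_lenE] that number
    is the hook length of the cell it contributes to. *)
Lemma hg_total f A : rpp_on D f -> hg D f A ->
  total f = \sum_(u <- cells) A u.1 u.2 * hook_len u.1 u.2.
Proof.
move=> fP H; elim: H fP => {f A} [f A f0 A0|f A B b c w fbc bc z W _ IH AB] fP.
  by rewrite /total !big1 // => u _; rewrite ?f0 ?A0.
have f1P := rpp_sub_walk Dmono fP W fbc z.
have [lo hi sz] := walk_size Dmono fP W fbc.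
have bcS := rpp_gt0 fP fbc; have /and3P[b0 c0 cD] := bcS.
rewrite (total_sub fP W fbc) IH //; move: (last _ _).1 => r in AB lo hi sz *.
rewrite [RHS](eq_bigr (fun u => B u.1 u.2 * hook_len u.1 u.2 +
    (u == (r, c)) * hook_len u.1 u.2)); last first.
  by case=> x y _; rewrite /= AB mulnDl xpair_eqE.
rewrite big_split /=; congr (_ + _).
have rc : (r, c) \in cells by rewrite mem_cells /in_shape; lia.
rewrite (bigD1_seq (r, c) rc uniq_cells) /=.
rewrite eqxx mul1n big1 ?addn0; last by move=> u /negPf ->.
by rewrite /hook_len (col_lenE bcS bc); lia.
Qed.

End Total.

(** * Bijectivity by induction on the shape *)

(** Shapes are dismantled from the end of the last row: an outer induction on the number of rows, an
    inner one on the length of the last row. *)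
Lemma shape_ind (P : (nat -> nat) -> Prop) :
    (forall D, (forall i, 0 < i -> D i.+1 <= D i) -> D 1 = 0 -> P D) ->
    (forall D n, (forall i, 0 < i -> D i.+1 <= D i) ->
      0 < n -> 0 < D n -> D n.+1 = 0 -> P (shrink D n) -> P D) ->
  forall D n, (forall i, 0 < i -> D i.+1 <= D i) -> D n.+1 = 0 -> P D.
Proof.
move=> P0 PS D n; elim: n D => [|n IHn] D; first by exact: P0.
move e: (D n.+1) => k; elim: k D e => [|k IHk] D e Dm Dn2; first by apply: IHn.
have Dn : 0 < D n.+1 by rewrite e.
apply: (PS D n.+1) => //; apply: IHk.
- by rewrite /shrink eqxx e.
- exact: shrink_mono.
- by rewrite /shrink; case: eqP => //; lia.
Qed.

Lemma in_shape0 D i j : (forall i, 0 < i -> D i.+1 <= D i) -> D 1 = 0 ->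
  in_shape D i j = false.
Proof.
move=> Dm D1; apply/negP => ij; have := rows_le Dm D1 ij.
by case/and3P: ij; lia.
Qed.

(** The prescribed corner value is the multiplicity handed to [related_insert]; [hg_related] and
    determinism then identify the image of the filling obtained. *)
Lemma hg_surj D n A : (forall i, 0 < i -> D i.+1 <= D i) -> D n.+1 = 0 ->
    (forall i j, ~~ in_shape D i j -> A i j = 0) ->
  exists f, rpp_on D f /\ hg D f A.
Proof.
move=> Dm Dn1; move: D n Dm Dn1 A.
apply: shape_ind => [D Dm D1 A A0|D n Dm n0 Dn Dn1 IH A A0].
  exists (fun _ _ => 0); split=> //; apply: hg_zero => // i j.
  by apply: A0; rewrite in_shape0.
have [i j|g [gP gA]] := IH (fun i j => if (i, j) == (n, D n) then 0 else A i j).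
  by rewrite in_shrink //; case: ifP => // _; rewrite andbT; apply: A0.
have [f fg] := related_insert Dm n0 Dn Dn1 (A n (D n)) gP.
have [fP _ _ _] := fg; have [B fB] := hg_exists Dm Dn1 fP.
exists f; split=> //; have [gB Ba] := hg_related Dm n0 Dn Dn1 fB fg.
apply: hg_ext fB => i j; have := hg_det (shrink_mono Dm n0 Dn Dn1) gP gB gA i j.
by case: eqP => [[-> ->]|].
Qed.

Lemma hg_inj D n f1 f2 A : (forall i, 0 < i -> D i.+1 <= D i) -> D n.+1 = 0 ->
    rpp_on D f1 -> rpp_on D f2 -> hg D f1 A -> hg D f2 A ->
  forall i j, f1 i j = f2 i j.
Proof.
move=> Dm Dn1; move: D n Dm Dn1 f1 f2 A.
apply: shape_ind => [D Dm D1|D n Dm n0 Dn Dn1 IH] f1 f2 A f1P f2P H1 H2 i j.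
  have ij : ~~ in_shape D i j by rewrite in_shape0.
  by case: f1P => -> //; case: f2P => ->.
have [g1 [a1 R1]] := related_remove Dm n0 Dn Dn1 f1P.
have [g2 [a2 R2]] := related_remove Dm n0 Dn Dn1 f2P.
have [G1 E1] := hg_related Dm n0 Dn Dn1 H1 R1.
have [G2 E2] := hg_related Dm n0 Dn Dn1 H2 R2.
have [_ g1P _ _] := R1; have [_ g2P _ _] := R2.
have eg : g1 = g2 by do 2 apply/funext => ?; apply: (IH _ _ _ g1P g2P G1 G2).
by subst g2 a1 a2; apply: related_inj R1 R2 i j.
Qed.

(** * Diagonal supports and longest chains *)

(** If both neighbours vanish, so does everything further out, and the load arrives undiminished as
    [a]; then [Q t] is [a], capped by [P t] when t is positive. Only the positivity of [a] enters,
    which is why supports alone decide. *)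
Lemma carry_rule_gt0 mu nu Q P C a n t :
    interlacing mu nu Q P -> carry_rule mu nu Q P C a n ->
  (0 < Q t) = [|| 0 < mu t.+1, 0 < nu t.+1 | (0 < a) && ((t == 0) || (0 < P t))].
Proof.
move=> I [R0 RQ RC Ra].
have drained : mu t.+1 = 0 -> nu t.+1 = 0 -> C t = a.
  move=> mt nt; suff H d : [/\ C t = C (t + d), mu (t + d).+1 = 0 & nu (t + d).+1 = 0].
    by have [-> _ _] := H n; rewrite Ra // leq_addl.
  elim: d => [|d [Hc Hm Hn]]; first by rewrite addn0.
  by move: (I (t + d)) (RC (t + d)); rewrite addnS; split; lia.
have [h|] := boolP ((0 < mu t.+1) || (0 < nu t.+1)).
  by move: (I t); lia.
rewrite negb_or -!leqNgt !leqn0 => /andP[/eqP mt /eqP nt]; move: (drained mt nt).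
by case: t mt nt {drained} => [|t] mt nt Ct; [|move: (RQ t)]; lia.
Qed.

Fixpoint diag_supp (f : nat -> nat -> nat) p q : nat :=
  match p, q with
  | p'.+1, q'.+1 => (0 < f p q) + diag_supp f p' q'
  | _, _ => 0
  end.

(** Longest chain in the support of [A] within rows 1 to p and columns 1 to q, as [chain_le] and
    [chain_exists] confirm. The inner [fix] makes the double recursion structural. *)
Fixpoint max_chain (A : nat -> nat -> nat) p : nat -> nat :=
  if p is p'.+1 then
    fix row q := if q is q'.+1 then
      maxn (maxn (max_chain A p' q) (row q')) (max_chain A p' q' + (0 < A p q))
    else 0
  else fun=> 0.

Lemma max_chainS A p q : max_chain A p.+1 q.+1 =
  maxn (maxn (max_chain A p q.+1) (max_chain A p.+1 q))
       (max_chain A p q + (0 < A p.+1 q.+1)).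
Proof. by []. Qed.

Lemma max_chainE A p q : 0 < p -> 0 < q -> max_chain A p q =
  maxn (maxn (max_chain A p.-1 q) (max_chain A p q.-1))
       (max_chain A p.-1 q.-1 + (0 < A p q)).
Proof. by case: p q => [|p] [|q]. Qed.

Lemma max_chain0 A p : max_chain A p 0 = 0.
Proof. by case: p. Qed.

Lemma eq_max_chain A B p q :
  (forall i j, i <= p -> j <= q -> A i j = B i j) -> max_chain A p q = max_chain B p q.
Proof.
elim: p q => // p IHp; elim=> [|q IHq] AB; first by rewrite !max_chain0.
by rewrite !max_chainS AB // IHq ?IHp // => i j ip jq; apply: AB; lia.
Qed.

Lemma eq_diag_supp f g p q :
  (forall t, f (p - t) (q - t) = g (p - t) (q - t)) ->
  diag_supp f p q = diag_supp g p q.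
Proof.
elim: p q => [|p IH] [|q] //= fg; have := fg 0; rewrite !subn0 => ->.
by rewrite (IH q) // => t; have := fg t.+1; rewrite !subSS.
Qed.

Lemma diag_supp_ltE f p q t :
    (forall x y, 0 < x < p -> 0 < y < q -> 0 < f x y -> 0 < f x.+1 y.+1) ->
  (t < diag_supp f p q) = [&& t < p, t < q & 0 < f (p - t) (q - t)].
Proof.
elim: p q t => [|p IH] q t mono; first by rewrite ltn0.
case: q mono => [|q] mono; first by rewrite ltn0 /= andbF.
have IH' u : (u < diag_supp f p q) = [&& u < p, u < q & 0 < f (p - u) (q - u)].
  by apply: IH => x y hx hy; apply: mono; lia.
have step u : u < p -> u < q -> 0 < f (p - u) (q - u) -> 0 < f p.+1 q.+1.
  elim: u => [|u IHu] up uq; rewrite ?subn0; first by apply: mono; lia.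
  move=> h; apply: IHu; [lia|lia|]; rewrite (_ : p - u = (p - u.+1).+1); last by lia.
  by rewrite (_ : q - u = (q - u.+1).+1); [apply: mono; lia|lia].
rewrite /=; case: t => [|t]; rewrite ?subn0 ?subSS.
  by have := IH' 0; rewrite !subn0; move: (step 0); rewrite !subn0; lia.
by have := IH' t; have := IH' 0; rewrite !subn0; move: (step t); lia.
Qed.

Lemma diag_supp_gt D f p q t : (forall i, 0 < i -> D i.+1 <= D i) -> rpp_on D f ->
    (0 < p -> 0 < q -> in_shape D p q) ->
  (t < diag_supp f p q) = (0 < f (p - t) (q - t)).
Proof.
move=> Dm fP pq; rewrite diag_supp_ltE => [|x y hx hy fxy]; last first.
  apply: leq_trans fxy (rpp_le Dm fP _ _ _) => //.
  have pqS : in_shape D p q by apply: pq; lia.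
  by apply: (in_shape_le Dm pqS); lia.
have [pt|tp] := leqP p t; first by rewrite (_ : p - t = 0) ?(rpp_row0 fP) //; lia.
by have [qt|//] := leqP q t; rewrite (_ : q - t = 0) ?(rpp_col0 fP) //; lia.
Qed.

Lemma diag_suppE f p q :
  diag_supp f p q = count (fun t => 0 < f (p - t) (q - t)) (iota 0 (minn p q)).
Proof.
elim: p q => [|p IH] [|q] //; rewrite ?minn0 // minnSS /= !subn0 IH; congr (_ + _).
by rewrite -[1]/(1 + 0) iotaDl count_map; apply: eq_count => t /=; rewrite !subSS.
Qed.

(** A boundary cell other than the corner lies on a diagonal that deletion leaves unchanged. At the
    corner, the two sides are compared threshold by threshold through [carry_rule_gt0]. *)
Theorem diag_supp_max_chain D n f A p q :
    (forall i, 0 < i -> D i.+1 <= D i) -> D n.+1 = 0 ->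
    rpp_on D f -> hg D f A ->
    in_shape D p q -> ~~ in_shape D p.+1 q.+1 ->
  diag_supp f p q = max_chain A p q.
Proof.
move=> Dm Dn1; move: D n Dm Dn1 f A p q.
apply: shape_ind => [D Dm D1|D n Dm n0 Dn Dn1 IH] f A p q fP H pq pq1.
  by rewrite in_shape0 in pq.
have [g [a R]] := related_remove Dm n0 Dn Dn1 fP.
have [gH Aa] := hg_related Dm n0 Dn Dn1 H R.
have [_ gP fg [C RC]] := R.
have I := interlacing_related Dm n0 Dn Dn1 fP gP fg.
have pn := in_shape_row Dm n0 Dn Dn1 pq.
have Dm' := shrink_mono Dm n0 Dn Dn1.
set A' := fun i j => _ in gH.
have AA' x y : x < n \/ y < D n -> max_chain A x y = max_chain A' x y.
  move=> xy; apply: eq_max_chain => i j ix jy; rewrite /A'; case: eqP => // -[ei ej]; lia.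
have IHg x y : in_shape (shrink D n) x y -> ~~ in_shape (shrink D n) x.+1 y.+1 ->
  x < n \/ y < D n -> diag_supp g x y = max_chain A x y.
  by move=> h1 h2 h3; rewrite AA' // (IH _ _ _ _ gP gH).
have [[ep eq]|ne] := eqVneq (p, q) (n, D n); last first.
  have xy : p < n \/ q < D n.
    have [|np] := ltnP p n; [by left|right].
    have ep : p = n by lia.
    subst p; have /and3P[_ _ qD] := pq; rewrite ltn_neqAle qD andbT.
    by apply: contraNneq ne => ->.
  have off : p + D n != q + n.
    apply/eqP => e; move/negP: pq1; apply; have [pq0 _] := andP pq.
    by apply: (in_shapeP Dm n0 Dn); lia.
  rewrite -IHg //; first last.
  - by rewrite in_shrink // (negPf pq1).
  - by rewrite in_shrink // pq.
  apply: eq_diag_supp => t.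
  have [pt|tp] := leqP p t.
    by rewrite (_ : p - t = 0) ?(rpp_row0 fP) ?(rpp_row0 gP) //; lia.
  have [qt|tq] := leqP q t.
    by rewrite (_ : q - t = 0) ?(rpp_col0 fP) ?(rpp_col0 gP) //; lia.
  by rewrite fg //; lia.
subst p q.
have gE x y : x <= n -> y <= D n -> x < n \/ y < D n ->
    (0 < x -> 0 < y -> ~~ in_shape (shrink D n) x.+1 y.+1) ->
    diag_supp g x y = max_chain A x y.
  move=> xn yD xy h; have [->|x0] := posnP x; first by case: y {yD xy h}.
  have [->|y0] := posnP y; first by rewrite max_chain0; case: x {x0 xn xy h}.
  apply: IHg => //; last exact: h.
  rewrite in_shrink // (in_shapeP Dm n0 Dn) ?x0 ?y0 //= xpair_eqE; lia.
have n1 : n.-1.+1 = n by rewrite prednK.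
have q1 : (D n).-1.+1 = D n by rewrite prednK.
rewrite max_chainE // Aa.
(* Once the corner is deleted, the cells north, west and north-west of it have no south-east
   neighbour in the shape, so the induction hypothesis covers all three. *)
rewrite -!gE; try lia.
- apply/eqP; rewrite eqn_leq; apply/andP.
  have lt_eq x y : (forall t, (t < x) = (t < y)) -> x <= y /\ y <= x.
    move=> h; split; [have := h y|have := h x]; lia.
  apply: lt_eq => t.
  have G x y u : x <= n -> y <= D n -> x < n \/ y < D n ->
     (u < diag_supp g x y) = (0 < g (x - u) (y - u)).
    move=> xn yD xy; apply: (diag_supp_gt _ Dm' gP) => x0 y0.
    by rewrite in_shrink // (in_shapeP Dm n0 Dn) ?x0 ?y0 //= xpair_eqE; lia.
  have Ff : (t < diag_supp f n (D n)) = (0 < diag D n f t).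
    by apply: (diag_supp_gt _ Dm fP).
  have [eb ea] := off_diag n0 Dn Dn1 fg fP gP.
  have Fa : (t < diag_supp g n.-1 (D n)) = (0 < above D n f t.+1).
    rewrite G; try lia.
    by rewrite -ea /above subSS; congr (0 < g _ _); lia.
  have Fb : (t < diag_supp g n (D n).-1) = (0 < below D n f t.+1).
    rewrite G; try lia.
    by rewrite -eb /below subSS; congr (0 < g _ _); lia.
  have Fc u : (u < diag_supp g n.-1 (D n).-1) = (0 < diag D n g u.+1).
    rewrite G; try lia.
    by rewrite /diag; congr (0 < g _ _); lia.
  rewrite Ff (carry_rule_gt0 t I RC) !leq_max Fa Fb; move: (I t) (Fc t).
  case: t {Ff Fa Fb} => [|t]; [|move: (Fc t)]; lia.
- by move=> _ _; rewrite n1 q1 in_shrink // eqxx andbF.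
- by move=> _ _; rewrite q1 /in_shape /shrink; case: eqP; rewrite ?Dn1; lia.
- by move=> _ _; rewrite n1 /in_shape /shrink eqxx; lia.
Qed.

(** * Grid coordinates for the fillings of the statement *)

Section Bridge.
Variable la : seq nat.
Hypothesis la_part : is_partition la.
Local Notation cell := (cell (diagram la)).
Local Notation filling := (filling (diagram la)).

Definition rows i := part la i.-1.
Local Notation D := rows.
Local Notation n := (size la).

Lemma part_mono i j : i <= j -> part la j <= part la i.
Proof.
move=> ij; have [nj|jn] := leqP n j; first by rewrite /part (nth_default _ nj).
have /andP[s _] := la_part.
have := sorted_leq_nth (fun y x z h1 h2 => leq_trans h2 h1 : geq x z) leqnn 0 s.
by apply; rewrite ?inE //; lia.
Qed.

Lemma rows_mono i : 0 < i -> D i.+1 <= D i.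
Proof. by case: i => // i _; apply: part_mono. Qed.

Lemma rows_end : D n.+1 = 0.
Proof. by rewrite /rows /part nth_default. Qed.

Lemma part_gt0 i : i < n -> 0 < part la i.
Proof.
have /andP[_ z] := la_part => ltin; rewrite lt0n; apply: contraNneq z => <-.
exact: mem_nth.
Qed.

Lemma mem_diagram i j : ((i, j) \in diagram la) = (j < part la i).
Proof.
apply/allpairsPdep/idP => [[x [y [_ hy [-> ->]]]]|ji].
  by move: hy; rewrite mem_iota.
exists i, j; rewrite !mem_iota; split=> //.
by rewrite ltnNge; apply: contraL ji => h; rewrite /part nth_default.
Qed.

Lemma shape_diagram i j : in_shape D i.+1 j.+1 = ((i, j) \in diagram la).
Proof. by rewrite mem_diagram. Qed.

Definition pos (u : cell) : nat * nat := ((row_of u).+1, (col_of u).+1).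

Lemma pos_inj : injective pos.
Proof.
move=> u v [e1 e2]; apply: val_inj; move: e1 e2; rewrite /row_of /col_of.
by case: (val u) (val v) => [? ?] [? ?] /= -> ->.
Qed.

Lemma pos_shape u : in_shape D (pos u).1 (pos u).2.
Proof. by rewrite shape_diagram; have := valP u; rewrite -surjective_pairing. Qed.

Lemma shape_pos i j : in_shape D i j -> exists u, pos u = (i, j).
Proof.
case: i j => [|i] [|j]; rewrite ?[in_shape _ _ 0]andbF // shape_diagram => ij.
by exists (Sub (i, j) ij); rewrite /pos /row_of /col_of SubK.
Qed.

Definition entry (pi : filling) i j : nat :=
  if (i, j) is (i'.+1, j'.+1) then oapp pi 0 (cell_at (diagram la) i' j') else 0.

Lemma entry_pos pi u : entry pi (pos u).1 (pos u).2 = pi u.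
Proof.
by rewrite /entry /= /cell_at /row_of /col_of -surjective_pairing valK.
Qed.

Lemma entry_out pi i j : ~~ in_shape D i j -> entry pi i j = 0.
Proof.
case: i j => [|i] [|j] //; rewrite shape_diagram => ij.
by rewrite /entry /cell_at insubN.
Qed.

Lemma entry_ext (pi : filling) (f : nat -> nat -> nat) :
    (forall u, pi u = f (pos u).1 (pos u).2) ->
    (forall i j, ~~ in_shape D i j -> f i j = 0) ->
  forall i j, entry pi i j = f i j.
Proof.
move=> h1 h2 i j; have [/shape_pos [u e]|ij] := boolP (in_shape D i j).
  by have := entry_pos pi u; rewrite h1 e.
by rewrite entry_out ?h2.
Qed.

Lemma entry_inj pi1 pi2 : (forall i j, entry pi1 i j = entry pi2 i j) -> pi1 = pi2.
Proof. by move=> h; apply/ffunP => u; rewrite -!entry_pos h. Qed.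

Lemma rpp_entry (pi : filling) : is_rpp pi -> rpp_on D (entry pi).
Proof.
move/forallP => H; have {}H u v : [|| (row_of u == row_of v) && (col_of u <= col_of v)
      | (col_of u == col_of v) && (row_of u <= row_of v)] -> pi u <= pi v.
  by have /forallP/(_ v)/implyP := H u.
have mono i j i' j' : in_shape D i' j' ->
  (i == i') && (j <= j') || (j == j') && (i <= i') ->
  entry pi i j <= entry pi i' j'.
  move=> /shape_pos [v ev] h; have := entry_pos pi v; rewrite ev /= => ->.
  have [/shape_pos [u eu]|ij] := boolP (in_shape D i j); last by rewrite entry_out.
  have := entry_pos pi u; rewrite eu /= => ->; apply: H.
  by move: eu ev h; rewrite /pos => -[<- <-] [<- <-].
split=> [i j|i j ij|i j ij]; first exact: entry_out.
  by apply: mono; rewrite // eqxx leqnSn orbT.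
by apply: mono; rewrite // eqxx leqnSn.
Qed.

Lemma entry_rpp (pi : filling) : rpp_on D (entry pi) -> is_rpp pi.
Proof.
move=> P; apply/forallP => u; apply/forallP => v; apply/implyP => h.
rewrite -!entry_pos; apply: (rpp_le rows_mono P (pos_shape v)); rewrite /=; lia.
Qed.

Lemma perm_cells : perm_eq (cells D n) (map pos (enum cell)).
Proof.
apply: uniq_perm; first exact: uniq_cells.
  by rewrite map_inj_uniq ?enum_uniq //; exact: pos_inj.
case=> i j; rewrite (mem_cells rows_mono rows_end).
apply/idP/mapP => [/shape_pos [u <-]|[u _ e]].
  by exists u; rewrite ?mem_enum.
by have := pos_shape u; rewrite -e.
Qed.

Lemma sum_cells F : \sum_(x <- cells D n) F x = \sum_u F (pos u) :> nat.
Proof. by rewrite (perm_big _ perm_cells) big_map big_enum. Qed.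

Lemma conj_partE i j : (i < conj_part la j) = (j < part la i).
Proof.
have /andP[s _] := la_part; rewrite /conj_part /part.
elim: (la) s i => [|r l IH] s i /=; first by rewrite nth_nil !ltn0.
have sl : sorted geq l := path_sorted s.
case: i => [|i] /=.
  case: (ltnP j r) => // rj; rewrite /= ?add0n; apply/negbTE; rewrite -leqNgt leqn0.
  rewrite -leqn0 leqNgt -has_count; apply/hasPn => x xl; rewrite -leqNgt.
  have := order_path_min (fun y x z h1 h2 => leq_trans h2 h1 : geq x z) s.
  by move/allP/(_ x xl) => h; apply: leq_trans rj.
case: (ltnP j r) => rj; first by rewrite /= ?add1n ltnS IH.
rewrite /= ?add0n; apply/idP/idP.
  move=> h; have : 0 < count [eta leq j.+1] l by apply: leq_ltn_trans h.
  rewrite -has_count => /hasP[x xl jx].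
  have := order_path_min (fun y x z h1 h2 => leq_trans h2 h1 : geq x z) s.
  by move/allP/(_ x xl) => /= ?; lia.
move=> h; have il : i < size l by rewrite ltnNge; apply: contraL h => /(nth_default 0) ->.
have := order_path_min (fun y x z h1 h2 => leq_trans h2 h1 : geq x z) s.
by move/allP/(_ _ (mem_nth 0 il)) => /= ?; lia.
Qed.

Lemma conj_shape i j : in_shape D i.+1 j.+1 ->
  in_shape D (conj_part la j) j.+1 /\ ~~ in_shape D (conj_part la j).+1 j.+1.
Proof.
rewrite shape_diagram mem_diagram -conj_partE => h.
rewrite shape_diagram mem_diagram -conj_partE ltnn; split=> //.
by case e: (conj_part la j) h => [|c] // _; rewrite shape_diagram mem_diagram -conj_partE e.
Qed.

Lemma hook_pos (u : cell) : hook_len D n (pos u).1 (pos u).2 = hook la (val u).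
Proof.
have ij := pos_shape u; have [c1 c2] := conj_shape ij.
rewrite /hook_len (col_lenE rows_mono rows_end c1 c2) /hook.
move: ij; rewrite shape_diagram mem_diagram /= => h1.
have := h1; rewrite -conj_partE => h2.
by rewrite /rows /= -/(row_of u) -/(col_of u); lia.
Qed.

Lemma hook_gt0 (u : cell) : 0 < hook la (val u).
Proof. by rewrite -hook_pos /hook_len addn1. Qed.

End Bridge.

(** * From the executable algorithm to walks *)

Section Bridge.
Variable la : seq nat.
Hypothesis la_part : is_partition la.
Local Notation cell := (cell (diagram la)).
Local Notation filling := (filling (diagram la)).
Local Notation D := (rows la).
Local Notation n := (size la).
Local Notation entry := (@entry la).
Local Notation pos := (@pos la).

(** Strict growth of the content, written without subtraction. As a strict order it excludes
    repetitions, hence bounds the path by the number of cells. *)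
Definition steps_east : rel cell :=
  fun u v => col_of u + row_of v < col_of v + row_of u.

Lemma hg_next_cases (pi : filling) u v : 0 < pi u -> hg_next pi u = Some v ->
  (pos v = (row_of u, (col_of u).+1) /\ pi v = pi u) \/
  [/\ pos v = ((row_of u).+1, (col_of u).+2), entry pi (row_of u) (col_of u).+1 != pi u
    & (col_of u).+1 < D (row_of u).+1].
Proof.
move=> piu; rewrite /hg_next /north.
have Eat i j w : cell_at (diagram la) i j = Some w ->
    pos w = (i.+1, j.+1) /\ j < part la i.
  rewrite /cell_at; case: insubP => // w' ij e [<-].
  by rewrite /pos /row_of /col_of e -mem_diagram.
have east_case : entry pi (row_of u) (col_of u).+1 != pi u -> east u = Some v ->
   [/\ pos v = ((row_of u).+1, (col_of u).+2), entry pi (row_of u) (col_of u).+1 != pi u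
    & (col_of u).+1 < D (row_of u).+1].
  by move=> h /Eat [].
case er: (row_of u) east_case => [|i] ec; first by move=> h; right; apply: ec; rewrite // eq_sym -lt0n.
case e: (cell_at _ i (col_of u)) => [w|]; last first.
  by move=> h; right; apply: ec; rewrite // /entry /= e eq_sym -lt0n.
case: eqP => ew; last by move=> h; right; apply: ec; rewrite // /entry /= e; apply/eqP.
by case=> <-; left; split=> //; have [-> _] := Eat _ _ _ e.
Qed.

Lemma hg_next_none (pi : filling) u : 0 < pi u -> hg_next pi u = None ->
  entry pi (row_of u) (col_of u).+1 != pi u /\ D (row_of u).+1 <= (col_of u).+1.
Proof.
move=> piu; rewrite /hg_next /north.
have ec : east u = None -> D (row_of u).+1 <= (col_of u).+1.
  rewrite /east /cell_at; case: insubP => //; rewrite mem_diagram -leqNgt //.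
case er: (row_of u) ec => [|i] ec; first by move/ec; split; rewrite // eq_sym -lt0n.
case e: (cell_at _ i (col_of u)) => [w|]; last first.
  by move/ec; split; rewrite // /entry /= e eq_sym -lt0n.
case: eqP => // ew /ec; split=> //; rewrite /entry /= e; exact/eqP.
Qed.

Lemma hg_path_east (pi : filling) k u : rpp_on D (entry pi) -> 0 < pi u ->
  path steps_east u (hg_path pi k u).
Proof.
move=> P; elim: k u => // k IH u piu /=; case e: (hg_next pi u) => [v|] //=.
have [[ev eqv]|[ev ne lt]] := hg_next_cases piu e.
  rewrite IH ?eqv // andbT /steps_east.
  by case: ev; lia.
rewrite IH ?andbT; first by rewrite /steps_east; case: ev => -> ->; lia.
apply: leq_trans piu _; rewrite -!(entry_pos pi) ev.
by apply: (rpp_le (rows_mono la_part) P); rewrite //= /in_shape.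
Qed.

Lemma hg_path_size (pi : filling) k u : rpp_on D (entry pi) -> 0 < pi u ->
  size (hg_path pi k u) < #|cell|.
Proof.
move=> P piu; have := hg_path_east k P piu => h.
have : uniq (u :: hg_path pi k u).
  apply: (sorted_uniq (leT := steps_east)) => //.
    by move=> x y z; rewrite /steps_east; lia.
  by move=> x; rewrite /steps_east ltnn.
by move/card_uniqP => /= <-; apply: max_card.
Qed.

(** Running out of the bound shows as a path of size exactly [k]; otherwise the path ended by its
    own rule and is a walk. *)
Lemma hg_path_walk (pi : filling) k u : rpp_on D (entry pi) -> 0 < pi u ->
  size (hg_path pi k u) = k \/
  walk D (entry pi) (pos u).1 (pos u).2 (map pos (u :: hg_path pi k u)).
Proof.
move=> P; elim: k u => [|k IH] u piu /=; first by left.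
have pu := entry_pos pi u.
case e: (hg_next pi u) => [v|]; last first.
  have [ne le] := hg_next_none piu e; right; apply: walk_stop => //=.
  by rewrite pu.
have [[ev eqv]|[ev ne lt]] := hg_next_cases piu e.
  have piv : 0 < pi v by rewrite eqv.
  have [/= ->|W] := IH v piv; [by left|right].
  apply: walk_north => /=; first by rewrite pu -eqv -entry_pos ev.
  by move: W; rewrite map_cons ev.
have piv : 0 < pi v.
  apply: leq_trans piu _; rewrite -!(entry_pos pi) ev.
  by apply: (rpp_le (rows_mono la_part) P); rewrite //= /in_shape.
have [/= ->|W] := IH v piv; [by left|right].
apply: walk_east => /=; first by rewrite pu.
  by [].
by move: W; rewrite map_cons ev.
Qed.

Lemma hg_walk (pi : filling) u : rpp_on D (entry pi) -> 0 < pi u ->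
  walk D (entry pi) (pos u).1 (pos u).2 (map pos (u :: hg_path pi #|cell| u)).
Proof.
move=> P piu; have [e|//] := hg_path_walk #|cell| P piu.
by have := hg_path_size #|cell| P piu; rewrite e ltnn.
Qed.

Lemma hg_columnP (pi : filling) : pi != zero_filling _ ->
  exists2 u, 0 < pi u & col_of u = hg_column pi /\
    forall v, col_of v < hg_column pi -> pi v = 0.
Proof.
move=> nz; pose a j := [exists u : cell, (col_of u == j) && (pi u != 0)].
have [u piu] : exists u, pi u != 0.
  apply/existsP; apply: contraNT nz; rewrite negb_exists => /forallP z.
  by apply/eqP/ffunP => u; rewrite ffunE; apply/eqP; have := z u; rewrite negbK.
have u0 (v : cell) : col_of v < part la 0.
  have := pos_shape v; rewrite shape_diagram mem_diagram => h.
  by apply: leq_trans h (part_mono la_part (leq0n _)).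
have ha : has a (iota 0 (part la 0)).
  apply/hasP; exists (col_of u); first by rewrite mem_iota /= u0.
  by apply/existsP; exists u; rewrite eqxx.
have lt : hg_column pi < part la 0 by move: ha; rewrite has_find size_iota.
have := nth_find 0 ha; rewrite nth_iota // add0n => /existsP[w /andP[/eqP cw piw]].
exists w; first by rewrite lt0n.
split=> // v hv; apply/eqP; have := before_find 0 hv; rewrite nth_iota ?u0 // add0n.
by move/negbT; rewrite negb_exists => /forallP/(_ v); rewrite eqxx negbK.
Qed.

Lemma hg_step_walk (pi A : filling) : rpp_on D (entry pi) -> pi != zero_filling _ ->
  exists b c w, [/\ 0 < entry pi b c, ~~ in_shape D b.+1 c,
    forall i j, j < c -> entry pi i j = 0, walk D (entry pi) b c w
    & entry (hg_step (pi, A)).1 = sub_walk (entry pi) w /\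
      forall i j, entry (hg_step (pi, A)).2 i j =
        entry A i j + ((i == (last (b, c) w).1) && (j == c))].
Proof.
move=> P nz; have [u piu [cu zc]] := hg_columnP nz.
have Dm := rows_mono la_part.
have [h1 h2] := conj_shape la_part (pos_shape u); rewrite /= cu in h1 h2.
set c := hg_column pi in cu zc h1 h2 *.
have [b eb] := shape_pos h1.
have bot : bottom_cell la c = Some b.
  rewrite /bottom_cell /cell_at; case: eb => <- <- /=.
  by rewrite /row_of /col_of -surjective_pairing valK.
have pib : 0 < pi b.
  apply: leq_trans piu _; rewrite -!(entry_pos pi) eb.
  apply: (rpp_le Dm P h1); last by rewrite /= cu.
  have := pos_shape u; rewrite shape_diagram mem_diagram -conj_partE //.
  by rewrite -/(col_of u) cu.
have W := hg_walk P pib; set p := hg_path pi #|cell| b in W.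
have lb : entry pi (conj_part la c) c.+1 = pi b by rewrite -entry_pos eb.
rewrite eb /= in W.
exists (conj_part la c), c.+1, (pos b :: map pos p); split=> //.
- by rewrite lb.
- move=> i j jc; have [/shape_pos [v ev]|/entry_out ->//] := boolP (in_shape D i j).
  have := entry_pos pi v; rewrite ev /= => ->; apply: zc.
  by case: ev jc => _ <-.
rewrite /hg_step (negPf nz) -/c bot /= -/p; split.
  apply/funext => i; apply/funext => j.
  apply: entry_ext => [v|i' j' ij]; last by rewrite /sub_walk entry_out.
  rewrite ffunE /sub_walk entry_pos -(mem_map (@pos_inj la)) /=.
  by congr (_ - _); rewrite -surjective_pairing.
pose F i j := entry A i j +
  ((i == (last (conj_part la c, c.+1) (pos b :: map pos p)).1) && (j == c.+1)).
move=> i j; apply: (entry_ext (f := F)) => [v|i' j' ij]; rewrite /F.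
  rewrite ffunE entry_pos; congr (_ + nat_of_bool _).
  by rewrite /= last_map /= !eqSS.
rewrite entry_out // add0n; case: andP => // -[/eqP ei /eqP ej].
have lb0 : 0 < entry pi (conj_part la c) c.+1 by rewrite lb.
have [lo hi _] := walk_size Dm P W lb0.
move: ij; rewrite /in_shape ei ej; rewrite /= in lo hi *; lia.
Qed.

Lemma weight_total (pi : filling) : weight pi = total D n (entry pi).
Proof.
rewrite /total (sum_cells la_part (fun x => entry pi x.1 x.2)).
by apply: eq_bigr => u _; rewrite entry_pos.
Qed.

(** The accumulator is arbitrary because the algorithm adds to it before the remaining steps, while
    [hg] adds after them. *)
Lemma hg_iter k (pi A : filling) : rpp_on D (entry pi) -> weight pi <= k ->
  exists2 B, hg D (entry pi) B &
    forall i j, entry (iter k (@hg_step la) (pi, A)).2 i j = entry A i j + B i j.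
Proof.
elim: k pi A => [|k IH] pi A P wk.
  have z u : pi u = 0.
    by apply/eqP; rewrite -leqn0; apply: leq_trans wk; rewrite /weight (bigD1 u) //= leq_addr.
  exists (fun _ _ => 0); last by move=> i j; rewrite addn0.
  by apply: hg_zero => // i j; rewrite (entry_ext (f := fun _ _ => 0)).
have [e|nz] := eqVneq pi (zero_filling _).
  exists (fun _ _ => 0).
    apply: hg_zero => // i j; rewrite (entry_ext (f := fun _ _ => 0)) // => u.
    by rewrite e ffunE.
  move=> i j; rewrite addn0; suff -> : iter k.+1 (@hg_step la) (pi, A) = (pi, A) by [].
  by elim: k.+1 => //= m ->; rewrite /hg_step e eqxx.
have [b [c [w [lb bc z W [e1 e2]]]]] := hg_step_walk A P nz.
have Dm := rows_mono la_part.
have P1 := rpp_sub_walk Dm P W lb z.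
rewrite -e1 in P1.
case e: (hg_step (pi, A)) => [pi1 A1]; rewrite e /= in e1 e2 P1.
have [|B HB EB] := IH pi1 A1 P1.
  have := total_sub Dm (rows_end la) P W lb; rewrite -e1 -!weight_total.
  by move: (walk_head W); case: w {W e1 e2} => //= *; lia.
exists (fun i j => B i j + ((i == (last (b, c) w).1) && (j == c))).
  by apply: (hg_cons lb bc z W) => //; rewrite -e1.
by move=> i j; rewrite iterSr e EB e2 addnA addnAC.
Qed.

Lemma hg_hillman_grassl (pi : filling) : is_rpp pi ->
  hg D (entry pi) (entry (hillman_grassl pi)).
Proof.
move=> /rpp_entry P; have [B HB EB] := hg_iter (zero_filling _) P (leqnn _).
apply: hg_ext HB => i j; rewrite EB (entry_ext (f := fun _ _ => 0)) // => u.
by rewrite ffunE.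
Qed.

Lemma hillman_grassl_inj (pi1 pi2 : filling) : is_rpp pi1 -> is_rpp pi2 ->
  hillman_grassl pi1 = hillman_grassl pi2 -> pi1 = pi2.
Proof.
move=> P1 P2 e; apply: entry_inj.
have H1 := hg_hillman_grassl P1; have H2 := hg_hillman_grassl P2; rewrite -e in H2.
exact: hg_inj (rows_mono la_part) (rows_end la) (rpp_entry P1) (rpp_entry P2) H1 H2.
Qed.

Lemma hillman_grassl_surj (A : filling) :
  exists2 pi : filling, is_rpp pi & hillman_grassl pi = A.
Proof.
have Dm := rows_mono la_part; have D1 := rows_end la.
have [f [fP fA]] := hg_surj Dm D1 (@entry_out la A).
pose pi : filling := [ffun u => f (pos u).1 (pos u).2].
have ef : entry pi = f.
  apply/funext => i; apply/funext => j; apply: entry_ext => [u|]; first by rewrite ffunE.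
  by case: fP.
have piP : is_rpp pi by apply: entry_rpp; rewrite ?ef.
exists pi => //; apply: entry_inj.
apply: (hg_det Dm fP _ fA); rewrite -ef; exact: hg_hillman_grassl.
Qed.

Lemma weight_hillman_grassl (pi : filling) : is_rpp pi ->
  weight pi = \sum_u hillman_grassl pi u * hook la (val u).
Proof.
move=> P; have H := hg_hillman_grassl P.
rewrite weight_total (hg_total (rows_mono la_part) (rows_end la) (rpp_entry P) H).
rewrite (sum_cells la_part (fun x => entry _ x.1 x.2 * hook_len D n x.1 x.2)).
by apply: eq_bigr => u _; rewrite entry_pos hook_pos.
Qed.

End Bridge.

(** * Pleasant diagrams *)

Section Bridge.
Variable la : seq nat.
Hypothesis la_part : is_partition la.
Local Notation cell := (cell (diagram la)).
Local Notation filling := (filling (diagram la)).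
Local Notation D := (rows la).
Local Notation n := (size la).
Local Notation entry := (@entry la).
Local Notation pos := (@pos la).
Let Dm := rows_mono la_part.

Lemma rect_fitsE k i q : (i%:Z + k = q%:Z)%R ->
  rect_fits la k i = [|| i == 0, q == 0 | in_shape D i q].
Proof.
move=> e; rewrite /rect_fits e /=.
apply/idP/idP => [|h].
  case: i q {e} => [|i] [|q] //= /forallP/(_ ord_max)/forallP/(_ ord_max) /=.
  by rewrite shape_diagram.
apply/forallP => a; apply/forallP => b.
have := ltn_ord a; have := ltn_ord b => bq ai.
have iq : in_shape D i q by move: h; case/or3P => // /eqP z; lia.
rewrite -shape_diagram; apply: (in_shape_le Dm iq); lia.
Qed.

(** The largest rectangle has its south-east corner at the last cell of diagonal k; this links
    [rect] to [max_chain] at a boundary cell. *)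
Lemma rect_spec (k : int) : (1 - n%:Z <= k <= (part la 0)%:Z - 1)%R ->
  exists p q, [/\ rect_rows la k = p, (p%:Z + k = q%:Z)%R, in_shape D p q
    & ~~ in_shape D p.+1 q.+1].
Proof.
move=> /andP[k1 k2].
(* The first cell of diagonal k, (1, k + 1) or (1 - k, 1), shows that a nonempty rectangle fits. *)
have [i0 [q0 [e0 s0]]] : exists i q, (i%:Z + k = q%:Z)%R /\ in_shape D i q.
  have [k0|k0] := boolP (0 <= k)%R.
    exists 1, (absz (k + 1)%R); split; first by lia.
    by rewrite /in_shape /rows; change 1.-1 with 0; lia.
  exists (absz (1 - k)%R), 1; split; first by lia.
  have : 0 < part la (absz (- k)%R) by apply: part_gt0 => //; lia.
  have e : (absz (1 - k)%R).-1 = absz (- k)%R by lia.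
  by rewrite /in_shape /rows e; lia.
have fits i q : (i%:Z + k = q%:Z)%R -> in_shape D i q -> i <= rect_rows la k.
  move=> e s; have ib : i < n.+1 by rewrite ltnS; apply: rows_le s => //; exact: rows_end.
  rewrite /rect_rows; apply: (bigop.bigmax_sup (Ordinal ib)) => //=.
  by rewrite (rect_fitsE e) s !orbT.
have i0p := fits _ _ e0 s0.
have [p pfit ep] : exists2 p, rect_fits la k p & rect_rows la k = p.
  have ib : i0 < n.+1 by rewrite ltnS; apply: rows_le s0 => //; exact: rows_end.
  have P0 : rect_fits la k (Ordinal ib) by rewrite (rect_fitsE e0) s0 !orbT.
  have [j pj ej] := eq_bigmax_cond (fun i : 'I_n.+1 => i : nat)
    (A := [pred i : 'I_n.+1 | rect_fits la k i])
    (ltac:(by apply/card_gt0P; exists (Ordinal ib))).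
  by exists j.
have /and3P[i00 q00 _] := s0.
exists p, (absz (p%:Z + k)%R); rewrite ep in i0p fits *.
have eq : (p%:Z + k = ((absz (p%:Z + k)%R))%:Z)%R by lia.
split=> //.
  by move: pfit; rewrite (rect_fitsE eq) => /or3P[/eqP|/eqP|//]; lia.
apply/negP => /(fits _ _ _) => h; have : p.+1 <= p by apply: h; lia.
by rewrite ltnn.
Qed.

Definition grows : rel cell :=
  fun u v => (row_of u < row_of v) && (col_of u < col_of v).

Lemma grows_trans : transitive grows.
Proof. by move=> x y z; rewrite /grows; lia. Qed.

Lemma max_chain_mono A p q p' q' : p <= p' -> q <= q' ->
  max_chain A p q <= max_chain A p' q'.
Proof.
have mq x y : max_chain A x y <= max_chain A x y.+1.
  by case: x => // x; rewrite max_chainS; lia.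
have mp x y : max_chain A x y <= max_chain A x.+1 y.
  by case: y => [|y]; [rewrite !max_chain0|rewrite max_chainS; lia].
move=> /subnKC <- /subnKC <-; elim: (p' - p) => [|d IH]; last first.
  by rewrite addnS (leq_trans IH).
rewrite addn0; elim: (q' - q) => [|d IH]; first by rewrite addn0.
by rewrite addnS (leq_trans IH).
Qed.

(** Induction on the last cell: the rectangle shrinks to the one ending there, and the rest of the
    chain lies strictly north-west of it. *)
Lemma chain_le A (S : {set cell}) p q s :
    (forall u, u \in S -> 0 < A (pos u).1 (pos u).2) ->
    sorted grows s ->
    (forall u, u \in s -> [/\ u \in S, row_of u < p & col_of u < q]) ->
  size s <= max_chain A p q.
Proof.
move=> AS; elim/last_ind: s p q => // s u IH p q ss sS.
have [uS up uq] : [/\ u \in S, row_of u < p & col_of u < q].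
  by apply: sS; rewrite mem_rcons mem_head.
apply: leq_trans (max_chain_mono A up uq); rewrite size_rcons max_chainS (AS u uS).
move: ss; rewrite (sorted_pairwise grows_trans) pairwise_rcons.
rewrite -(sorted_pairwise grows_trans) => /andP[/allP su ss].
rewrite addn1 leq_max ltnS; apply/orP; right; apply: IH => // v vs.
have [vS _ _] : [/\ v \in S, row_of v < p & col_of v < q].
  by apply: sS; rewrite mem_rcons inE vs orbT.
by have /andP[] := su v vs.
Qed.

Lemma chain_exists A (S : {set cell}) p q :
    (forall i j, 0 < A i j -> exists2 u, u \in S & pos u = (i, j)) ->
  exists s, [/\ sorted grows s,
    forall u, u \in s -> [/\ u \in S, row_of u < p & col_of u < q]
    & size s = max_chain A p q].
Proof.
move=> AS; elim: p q => [|p IHp] q; first by exists [::].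
elim: q => [|q [s [s1 s2 s3]]]; first by exists [::].
have [t [t1 t2 t3]] := IHp q.+1; have [r [r1 r2 r3]] := IHp q.
rewrite max_chainS.
have [h|h] := leqP (max_chain A p q + (0 < A p.+1 q.+1))
   (maxn (max_chain A p q.+1) (max_chain A p.+1 q)).
  have [h'|h'] := leqP (max_chain A p q.+1) (max_chain A p.+1 q).
    exists s; split=> // u /s2 [? ? ?]; split=> //; lia.
  exists t; split=> // u /t2 [? ? ?]; split=> //; lia.
have [A0|A0] := posnP (A p.+1 q.+1).
  exists r; split=> [//|u /r2 [? ? ?]|]; first by split=> //; lia.
  by rewrite addn0.
have [u uS eu] := AS _ _ A0.
have [er ec] : row_of u = p /\ col_of u = q by case: eu.
exists (rcons r u); split.
- rewrite (sorted_pairwise grows_trans) pairwise_rcons -(sorted_pairwise grows_trans) r1 andbT.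
  by apply/allP => v /r2 [_ ? ?]; rewrite /grows er ec; lia.
- move=> v; rewrite mem_rcons inE => /predU1P [->|/r2 [? ? ?]]; first by rewrite er ec.
  by split=> //; lia.
- by rewrite size_rcons r3 addn1.
Qed.

Variable mu : seq nat.
Hypothesis mu_part : is_partition mu.

Lemma pleasantE (A : filling) :
  pleasant mu (supp A) <->
  forall (k : int), (1 - n%:Z <= k <= (part la 0)%:Z - 1)%R ->
  forall p q, (p%:Z + k = q%:Z)%R -> in_shape D p q -> ~~ in_shape D p.+1 q.+1 ->
    max_chain (entry A) p q <= size (skew_diagonal la mu k).
Proof.
have rectE k p q : (1 - n%:Z <= k <= (part la 0)%:Z - 1)%R ->
  (p%:Z + k = q%:Z)%R -> in_shape D p q -> ~~ in_shape D p.+1 q.+1 ->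
  forall u, (u \in rect la k) = (row_of u < p) && (col_of u < q).
  move=> kr e s s' u; have [p' [q' [ep e' s1 s1']]] := rect_spec kr.
  have epp : p' = p.
    have lem x y x' y' : (x%:Z + k = y%:Z)%R -> (x'%:Z + k = y'%:Z)%R ->
      in_shape D x y -> ~~ in_shape D x'.+1 y'.+1 -> x <= x'.
      move=> e1 e2 h1 h2; rewrite leqNgt; apply: contra h2 => h.
      by apply: (in_shape_le Dm h1); lia.
    by apply/eqP; rewrite eqn_leq (lem _ _ _ _ e' e) // (lem _ _ _ _ e e').
  rewrite inE ep epp e; congr (_ && _); lia.
have suppA u : u \in supp A -> 0 < entry A (pos u).1 (pos u).2.
  by rewrite inE entry_pos lt0n.
have entryA i j : 0 < entry A i j -> exists2 u, u \in supp A & pos u = (i, j).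
  have [/shape_pos [u e]|/entry_out ->//] := boolP (in_shape D i j).
  by have := entry_pos A u; rewrite e /= => -> h; exists u; rewrite ?inE -?lt0n.
split=> H k kr.
  move=> p q e s s'; have [c [c1 c2 <-]] := chain_exists p q entryA.
  apply: (H k kr) => // u /c2 [uS up uq].
  by rewrite inE uS (rectE k p q) // up uq.
move=> s sS ds; have [p [q [_ e s1 s1']]] := rect_spec kr.
apply: leq_trans (H k kr p q e s1 s1'); apply: (chain_le suppA) => // u /sS.
by rewrite inE (rectE k p q) // => /and3P[].
Qed.

(** An indicator in coordinates counted from 1, so that the size of a skew diagonal becomes an
    instance of [diag_supp]. *)
Definition outside i j : nat := (i.-1, j.-1) \notin diagram mu.

Lemma size_skew_diagonal (k : int) p q :
    (p%:Z + k = q%:Z)%R -> in_shape D p q -> ~~ in_shape D p.+1 q.+1 ->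
  size (skew_diagonal la mu k) = diag_supp outside p q.
Proof.
move=> e s s'; rewrite diag_suppE -size_filter.
pose r t := ((p - t).-1, (q - t).-1).
rewrite -(size_map r); apply: perm_size; apply: uniq_perm.
- rewrite !filter_uniq //; apply: allpairs_uniq_dep => [|i _|]; rewrite ?iota_uniq //.
  by move=> [i1 j1] [i2 j2] /= _ _ [-> ->].
- rewrite map_inj_in_uniq ?filter_uniq ?iota_uniq // => t t'.
  rewrite !mem_filter !mem_iota => /andP[_ h] /andP[_ h'] [e1 _]; lia.
case=> i j; rewrite !mem_filter /=; apply/idP/mapP.
  move=> /and3P[/eqP ek out]; rewrite -shape_diagram => ij.
  have lt : i < p.
    rewrite ltnNge; apply: contra s' => h; apply: (in_shape_le Dm ij); lia.
  exists (p - i.+1); last by rewrite /r; congr (_, _); lia.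
  rewrite mem_filter mem_iota /outside.
  have -> : (p - (p - i.+1)).-1 = i by lia.
  have -> : (q - (p - i.+1)).-1 = j by lia.
  by rewrite out /=; lia.
case=> t; rewrite mem_filter mem_iota /outside => /andP[out h] [ei ej].
rewrite -ei -ej in out; have /and3P[p0 q0 _] := s.
apply/and3P; split; first by lia.
  by move: out; case: (_ \in _).
by rewrite -shape_diagram; apply: (in_shape_le Dm s); lia.
Qed.

Lemma supp_skewE (pi : filling) : is_rpp pi ->
  (forall u, u \in supp pi -> val u \in skew_diagram la mu) <->
  forall (k : int), (1 - n%:Z <= k <= (part la 0)%:Z - 1)%R ->
  forall p q, (p%:Z + k = q%:Z)%R -> in_shape D p q -> ~~ in_shape D p.+1 q.+1 ->
    diag_supp (entry pi) p q <= size (skew_diagonal la mu k).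
Proof.
move=> piP; have P := rpp_entry piP.
have outmono x y : 0 < outside x y -> 0 < outside x.+1 y.+1.
  rewrite /outside /= !lt0b; apply: contra; rewrite !mem_diagram // => h.
  by apply: leq_ltn_trans (leq_pred _) (leq_trans h (part_mono mu_part (leq_pred _))).
have gtE p q t : in_shape D p q ->
  (t < diag_supp (entry pi) p q) = (0 < entry pi (p - t) (q - t)).
  by move=> s; apply: diag_supp_gt Dm P _.
have gtO p q t : (t < diag_supp outside p q) =
  [&& t < p, t < q & 0 < outside (p - t) (q - t)].
  by apply: diag_supp_ltE => x y _ _; apply: outmono.
split=> H.
  move=> k kr p q e s s'; rewrite (size_skew_diagonal e s s').
  rewrite leqNgt; apply/negP => lt; have := lt; rewrite gtE //.
  (* If [pi] had more positive entries than the skew diagonal has cells, its entry at index t would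
     be positive, hence outside [mu], which would put t below the threshold t. *)
  set t := diag_supp outside p q => gt0.
  have st := rpp_gt0 P gt0; have [u eu] := shape_pos st.
  have uS : u \in supp pi by rewrite inE -lt0n -entry_pos eu.
  have := H u uS; rewrite mem_filter => /andP[out _].
  have : t < t by rewrite {2}/t gtO; have /and3P[? ? _] := st;
     rewrite /outside; case: eu => <- <-; rewrite /= -surjective_pairing out; lia.
  by rewrite ltnn.
move=> u uS; rewrite mem_filter (valP u) andbT.
have us := pos_shape u; have := us; rewrite shape_diagram mem_diagram => ju.
pose k : int := ((col_of u)%:Z - (row_of u)%:Z)%R.
have kr : (1 - n%:Z <= k <= (part la 0)%:Z - 1)%R.
  have := rows_le Dm (rows_end la) us; have := part_mono la_part (leq0n (row_of u)).
  by rewrite /= /k; lia.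
have [p [q [_ e s s']]] := rect_spec kr.
have up : row_of u < p.
  rewrite ltnNge; apply: contra s' => h; apply: (in_shape_le Dm us); rewrite /=; lia.
pose t := p - (row_of u).+1.
have e1 : p - t = (pos u).1 by rewrite /t /=; lia.
have e2 : q - t = (pos u).2 by rewrite /t /=; lia.
have : t < diag_supp outside p q.
  rewrite -(size_skew_diagonal e s s'); apply: leq_trans (H k kr p q e s s').
  by rewrite gtE // e1 e2 entry_pos lt0n; move: uS; rewrite inE.
by rewrite gtO e1 e2 /outside /= -surjective_pairing => /and3P[_ _]; case: (_ \in _).
Qed.

Lemma supp_skew_pleasant (pi : filling) : is_rpp pi ->
  (forall u, u \in supp pi -> val u \in skew_diagram la mu) <->
  pleasant mu (supp (hillman_grassl pi)).
Proof.
move=> piP; rewrite supp_skewE // pleasantE.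
have E p q : in_shape D p q -> ~~ in_shape D p.+1 q.+1 ->
  diag_supp (entry pi) p q = max_chain (entry (hillman_grassl pi)) p q.
  exact: (diag_supp_max_chain Dm (rows_end la) (rpp_entry piP)
    (hg_hillman_grassl la_part piP)).
by split=> H k kr p q e s s'; move: (H k kr p q e s s'); rewrite E.
Qed.

End Bridge.

(** * Extension by zero and the generating function *)

Lemma sum_seq_sub (T : choiceType) (s : seq T) (F : T -> nat) : uniq s ->
  \sum_(u : seq_sub s) F (val u) = \sum_(x <- s) F x.
Proof.
move=> us; rewrite -big_enum -(big_map val predT) /=; apply: perm_big.
apply: uniq_perm => //; first by rewrite map_inj_uniq ?enum_uniq //; exact: val_inj.
move=> x; apply/mapP/idP => [[u _ ->]|xs]; first exact: valP.
by exists (Sub x xs); rewrite ?mem_enum ?SubK.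
Qed.

Section Extension.
Variables la mu : seq nat.
Hypothesis mu_part : is_partition mu.
Local Notation filling := (filling (diagram la)).
Local Notation skew_filling := (Defs.filling (skew_diagram la mu)).

Definition extend (s : skew_filling) : filling :=
  [ffun u => oapp s 0 (cell_at (skew_diagram la mu) (row_of u) (col_of u))].
Definition restrict (pi : filling) : skew_filling :=
  [ffun v => entry pi (row_of v).+1 (col_of v).+1].

Lemma extend_in s (u : cell (diagram la)) (v : cell (skew_diagram la mu)) :
  val u = val v -> extend s u = s v.
Proof.
by rewrite ffunE /cell_at /row_of /col_of -surjective_pairing => ->; rewrite valK.
Qed.

Lemma extend_out s (u : cell (diagram la)) :
  val u \notin skew_diagram la mu -> extend s u = 0.
Proof.
by move=> h; rewrite ffunE /cell_at /row_of /col_of -surjective_pairing insubN.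
Qed.

Lemma skew_cell c : c \in skew_diagram la mu ->
  exists v : cell (skew_diagram la mu), val v = c.
Proof. by move=> h; exists (Sub c h); rewrite SubK. Qed.

Lemma skew_cellW (v : cell (skew_diagram la mu)) :
  exists u : cell (diagram la), val u = val v.
Proof.
by have := valP v; rewrite mem_filter => /andP[_ h]; exists (Sub (val v) h); rewrite SubK.
Qed.

Lemma supp_extend s u : u \in supp (extend s) -> val u \in skew_diagram la mu.
Proof. by rewrite inE; apply: contraR => /extend_out ->. Qed.

Lemma restrict_val (pi : filling) u v : val u = val v -> restrict pi v = pi u.
Proof. by move=> e; rewrite ffunE -(entry_pos pi u) /pos /row_of /col_of e. Qed.

Lemma extendK s : restrict (extend s) = s.
Proof.
by apply/ffunP => v; have [u e] := skew_cellW v; rewrite (restrict_val _ e) (extend_in _ e).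
Qed.

Lemma restrictK (pi : filling) :
  (forall u, u \in supp pi -> val u \in skew_diagram la mu) ->
  extend (restrict pi) = pi.
Proof.
move=> h; apply/ffunP => u; have [/skew_cell [v e]|out] := boolP (val u \in skew_diagram la mu).
  by rewrite (extend_in _ (esym e)) (restrict_val _ (esym e)).
rewrite extend_out //; apply/esym/eqP; move: out; apply: contraNT => piu.
by apply: h; rewrite inE.
Qed.

Lemma rpp_restrict (pi : filling) : is_rpp pi -> is_rpp (restrict pi).
Proof.
move=> /forallP P; apply/forallP => v; apply/forallP => v'; apply/implyP.
have [u e] := skew_cellW v; have [u' e'] := skew_cellW v'.
rewrite (restrict_val _ e) (restrict_val _ e') /row_of /col_of -e -e'.
by have /forallP/(_ u')/implyP := P u.
Qed.

(** The cells of [mu] are closed under going north and west, so an added zero never has to dominate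
    an old entry. *)
Lemma rpp_extend s : is_rpp s -> is_rpp (extend s).
Proof.
move=> /forallP P; apply/forallP => u; apply/forallP => u'; apply/implyP => h.
have [uin|out] := boolP (val u \in skew_diagram la mu); last by rewrite extend_out.
have u'in : val u' \in skew_diagram la mu.
  move: uin; rewrite !mem_filter (valP u') (valP u) !andbT; apply: contra.
  rewrite [val u]surjective_pairing [val u']surjective_pairing !mem_diagram //.
  move: h; rewrite /row_of /col_of => h lt.
  have h1 : (val u).1 <= (val u').1 by lia.
  have h2 : (val u).2 <= (val u').2 by lia.
  by apply: leq_ltn_trans h2 (leq_trans lt (part_mono mu_part h1)).
have [v e] := skew_cell uin; have [v' e'] := skew_cell u'in.
rewrite (extend_in _ (esym e)) (extend_in _ (esym e')).
have /forallP/(_ v')/implyP := P v; apply.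
by rewrite /row_of /col_of e e'.
Qed.

Lemma uniq_diagram : uniq (diagram la).
Proof.
apply: allpairs_uniq_dep => [|i _|]; rewrite ?iota_uniq //.
by move=> [i1 j1] [i2 j2] /= _ _ [-> ->].
Qed.

Lemma weight_extend s : weight (extend s) = weight s.
Proof.
pose F c := oapp s 0 (cell_at (skew_diagram la mu) c.1 c.2).
transitivity (\sum_(u : cell (diagram la)) F (val u)).
  by apply: eq_bigr => u _; rewrite ffunE.
transitivity (\sum_(v : cell (skew_diagram la mu)) F (val v)); last first.
  by apply: eq_bigr => v _; rewrite /F /cell_at -surjective_pairing valK.
rewrite !sum_seq_sub ?filter_uniq ?uniq_diagram // big_filter [RHS]big_mkcond /=.
rewrite [LHS]big_seq [RHS]big_seq; apply: eq_bigr => c cla.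
case: ifP => // /negbFE cmu; rewrite /F /cell_at -surjective_pairing insubN //.
by rewrite mem_filter cmu.
Qed.
End Extension.

Local Open Scope ring_scope.

(** * Truncated geometric series *)

Section Series.
Variable R : comNzRingType.
Implicit Types f g : fps R.

(** For the coefficient of degree n, each geometric series may be replaced by its terms with
    exponent index at most n. *)
Definition eq_upto n f g := forall i, (i <= n)%N -> fcoef f i = fcoef g i.

Lemma eq_upto_mul n f f' g g' : eq_upto n f f' -> eq_upto n g g' ->
  eq_upto n (f * g) (f' * g').
Proof.
move=> ff gg i ile; apply: eq_bigr => j _.
have ji : (j < i.+1)%N := ltn_ord j.
by rewrite ff ?gg //; lia.
Qed.

Lemma eq_upto_prod n (I : finType) (F G : I -> fps R) :
  (forall i, eq_upto n (F i) (G i)) -> eq_upto n (\prod_i F i) (\prod_i G i).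
Proof. by move=> FG; elim/big_ind2: _ => // *; apply: eq_upto_mul. Qed.

Lemma fcoef_sum n (I : finType) (P : pred I) (F : I -> fps R) :
  fcoef (\sum_(i | P i) F i) n = \sum_(i | P i) fcoef (F i) n.
Proof.
by elim/big_rec2: _ => // i x y _ <-.
Qed.

Lemma geometric n h : (0 < h)%N ->
  eq_upto n (fpsX ^+ h / (1 - fpsX ^+ h) : fps R)
    (\sum_(a < n.+1 | val a != 0) fpsX ^+ (a * h)).
Proof.
move=> h0; set x := fpsX ^+ h; have U : 1 - x \is a GRing.unit by apply: unit_1subXn.
have step m : x ^+ m / (1 - x) = x ^+ m + x ^+ m.+1 / (1 - x).
  by apply: (mulIr U); rewrite mulrDl !mulrVK // mulrBr mulr1 -exprSr subrK.
have E : x / (1 - x) = \sum_(a < n.+1 | val a != 0) x ^+ a + x ^+ n.+1 / (1 - x).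
  elim: n => [|m IH].
    by rewrite big_mkcond big_ord1 /= add0r expr1.
  rewrite big_mkcond big_ord_recr /= -big_mkcond -addrA -step; exact: IH.
move=> i ile; rewrite E.
transitivity (fcoef (\sum_(a < n.+1 | val a != 0) x ^+ a) i +
  fcoef (x ^+ n.+1 / (1 - x)) i) => //.
rewrite /x -exprM fcoef_XnM ifT ?addr0; last first.
  exact: leq_ltn_trans ile (leq_pmull n.+1 h0).
congr (fcoef _ i); apply: eq_bigr => a _; rewrite -exprM mulnC //.
Qed.

(** Expanding the product over all indices, with the factor 1 off S, chooses a multiplicity per
    index that is nonzero exactly on S. Multiplicities above n have too high a degree because each h
    is positive. *)
Lemma fcoef_prod_geometric n (I : finType) (S : {set I}) (h : I -> nat) :
    (forall i, 0 < h i)%N ->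
  fcoef (\prod_(i in S) (fpsX ^+ h i / (1 - fpsX ^+ h i)) : fps R) n =
  \sum_(a : {ffun I -> 'I_n.+1} | [set i | val (a i) != 0] == S)
    (n == \sum_i a i * h i)%N%:R.
Proof.
move=> h0; rewrite big_mkcond.
pose Q i := [pred a : 'I_n.+1 | (val a != 0) == (i \in S)].
transitivity (fcoef (\prod_i \sum_(a < n.+1 | Q i a) fpsX ^+ (a * h i) : fps R) n).
  apply: eq_upto_prod (leqnn n) => i; rewrite /Q /=; case: (boolP (i \in S)) => iS.
    have -> : \sum_(a < n.+1 | (val a != 0) == true) fpsX ^+ (a * h i) =
      \sum_(a < n.+1 | val a != 0) fpsX ^+ (a * h i) :> fps R.
      by apply: eq_bigl => a; rewrite eqb_id.
    exact: geometric.
  rewrite (big_pred1 ord0) => [|a]; first by rewrite mul0n expr0.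
  by rewrite /= eqbF_neg negbK.
rewrite bigA_distr_big_dep fcoef_sum; apply: eq_big => [a|a _].
  apply/familyP/eqP => [H|H i]; last by rewrite unfold_in /Q /= -H inE.
  by apply/setP => i; have := H i; rewrite unfold_in /Q /= inE => /eqP.
by rewrite -expr_sum fcoef_Xn.
Qed.
End Series.

Local Open Scope nat_scope.

(** * Counting skew fillings of a given weight *)

Section Counting.
Variables la mu : seq nat.
Hypotheses (la_part : is_partition la) (mu_part : is_partition mu).
Local Notation cell := (cell (diagram la)).
Local Notation filling := (filling (diagram la)).
Local Notation skew_filling := (Defs.filling (skew_diagram la mu)).
Variable n : nat.
Local Notation bounded := {ffun cell -> 'I_n.+1}.

Definition unbound (a : bounded) : filling := [ffun u => a u : nat].

Lemma unbound_inj : injective unbound.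
Proof.
move=> a b /ffunP e; apply/ffunP => u; apply: val_inj.
by have := e u; rewrite !ffunE.
Qed.

Definition inverse_hg (A : filling) : filling :=
  s2val (cid2 (hillman_grassl_surj la_part A)).

Lemma inverse_hg_rpp A : is_rpp (inverse_hg A).
Proof. by rewrite /inverse_hg; case: cid2. Qed.

Lemma inverse_hgK A : hillman_grassl (inverse_hg A) = A.
Proof. by rewrite /inverse_hg; case: cid2. Qed.

Definition counted : pred bounded :=
  [pred a | `[< pleasant mu (supp (unbound a)) >]
            & n == \sum_u a u * hook la (val u)].

Definition skew_rpp (a : bounded) : skew_filling :=
  restrict mu (inverse_hg (unbound a)).

Lemma supp_inverse_hg a : counted a -> forall u, u \in supp (inverse_hg (unbound a)) ->
  val u \in skew_diagram la mu.
Proof.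
case/andP=> /asboolP pl _; apply/(supp_skew_pleasant la_part mu_part (inverse_hg_rpp _)).
by rewrite inverse_hgK.
Qed.

Lemma skew_rpp_inj : {in counted &, injective skew_rpp}.
Proof.
move=> a b ac bc /(congr1 (@extend la mu)); rewrite /skew_rpp.
rewrite !restrictK; try exact: supp_inverse_hg.
by move/(congr1 (@hillman_grassl la)); rewrite !inverse_hgK => /unbound_inj.
Qed.

Lemma weight_skew_rpp a : counted a -> weight (skew_rpp a) = n.
Proof.
move=> ac; rewrite -(@weight_extend la mu) /skew_rpp restrictK; last exact: supp_inverse_hg.
rewrite (weight_hillman_grassl la_part (inverse_hg_rpp _)) inverse_hgK.
case/andP: ac => _ /eqP ->; apply: eq_bigr => u _; rewrite ffunE //.
Qed.

Lemma skew_rpp_surj (s : skew_filling) : is_rpp s -> weight s = n ->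
  exists2 a, counted a & skew_rpp a = s.
Proof.
move=> sP ws; have eP := rpp_extend mu_part sP.
have we := weight_hillman_grassl la_part eP; rewrite weight_extend ws in we.
set A := hillman_grassl _ in we.
(* Hook lengths are positive, so no entry of the array exceeds the weight; arrays bounded by n lose
   nothing. *)
have An u : A u < n.+1.
  rewrite ltnS we (bigD1 u) //= (leq_trans _ (leq_addr _ _)) // leq_pmulr //.
  exact: hook_gt0.
pose a : bounded := [ffun u => inord (A u)].
have aE u : a u = A u :> nat by rewrite ffunE inordK.
have aA : unbound a = A by apply/ffunP => u; rewrite ffunE aE.
exists a.
  apply/andP; split; last by rewrite {1}we; apply/eqP; apply: eq_bigr => u _; rewrite aE.
  apply/asboolP; rewrite aA; apply/(supp_skew_pleasant la_part mu_part eP) => u.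
  exact: supp_extend.
rewrite /skew_rpp aA -[RHS]extendK; congr restrict.
apply: (hillman_grassl_inj la_part) => //; first exact: inverse_hg_rpp.
by rewrite inverse_hgK.
Qed.

Definition skew_rpps : seq skew_filling := [seq skew_rpp a | a <- enum counted].

Lemma mem_skew_rpps s : (s \in skew_rpps) = is_rpp s && (weight s == n).
Proof.
apply/mapP/andP => [[a ac ->]|[sP /eqP ws]].
  rewrite mem_enum in ac; split; last by rewrite weight_skew_rpp.
  by apply: rpp_restrict; exact: inverse_hg_rpp.
by have [a ac <-] := skew_rpp_surj sP ws; exists a; rewrite ?mem_enum.
Qed.

Lemma uniq_skew_rpps : uniq skew_rpps.
Proof.
rewrite map_inj_in_uniq ?enum_uniq // => a b; rewrite !mem_enum.
exact: skew_rpp_inj.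
Qed.

Local Open Scope ring_scope.

(** Bounded arrays with pleasant support and hook-weighted sum n are sorted by their support S. *)
Lemma fcoef_pleasant_sum :
  fcoef (\sum_(S : {set cell} | `[< pleasant mu S >])
    \prod_(u in S) (fpsX ^+ hook la (val u) / (1 - fpsX ^+ hook la (val u))) : fps int) n
  = (#|counted|)%:R.
Proof.
have h0 (u : cell) : (0 < hook la (val u))%N by apply: hook_gt0.
rewrite fcoef_sum; under eq_bigr do rewrite fcoef_prod_geometric //.
pose Q (a : bounded) := `[< pleasant mu (supp (unbound a)) >].
have -> : (#|counted|)%:R = \sum_(a | Q a) (n == \sum_u a u * hook la (val u))%N%:R :> int.
  rewrite -sum1_card natr_sum.
  rewrite (eq_bigl (fun a => Q a && (n == \sum_u a u * hook la (val u))%N)) //.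
  by rewrite big_mkcondr; apply: eq_bigr => a _; case: ifP.
rewrite [RHS](partition_big (fun a : bounded => supp (unbound a))
  (fun S => `[< pleasant mu S >])) //=.
apply: eq_bigr => S pS; apply: eq_bigl => a.
have -> : supp (unbound a) = [set u | val (a u) != 0%N].
  by apply/setP => u; rewrite !inE ffunE.
have [eS|] := eqVneq; rewrite ?andbF // andbT /Q.
have -> : supp (unbound a) = [set u | val (a u) != 0%N].
  by apply/setP => u; rewrite !inE ffunE.
by rewrite eS pS.
Qed.

End Counting.

Local Open Scope ring_scope.

Theorem theorem6p3 (la mu : seq nat)
    (la_part : is_partition la) (mu_part : is_partition mu)
    (mu_la : {subset diagram mu <= diagram la}) :
  (forall pi : filling (diagram la), is_rpp pi ->
     (forall u, u \in supp pi -> val u \in skew_diagram la mu) <->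
     pleasant mu (supp (hillman_grassl pi)))
  /\
  has_fps_sum
    [set pi : filling (skew_diagram la mu) | is_rpp pi]%classic
    (fun pi => fpsX ^+ weight pi : fps int)
    (\sum_(S : {set cell (diagram la)} | `[< pleasant mu S >])
       \prod_(u in S)
         (fpsX ^+ hook la (val u) / (1 - fpsX ^+ hook la (val u)))).
Proof.
split=> [pi|n]; first exact: supp_skew_pleasant.
pose r := skew_rpps mu la_part n; have ur : uniq r := uniq_skew_rpps la_part mu_part n.
have mr s : (s \in r) = is_rpp s && (weight s == n) := mem_skew_rpps la_part mu_part n s.
have coef0 (s : filling (skew_diagram la mu)) : weight s != n ->
    fcoef (fpsX ^+ weight s : fps int) n = 0.
  by rewrite fcoef_Xn eq_sym => /negPf ->.
split.
  apply: sub_finite_set (finite_seq r) => s /= [sP] c0; rewrite mr sP /=.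
  by apply/negPn/negP => /coef0.
(* Only fillings of weight n contribute to this coefficient, each with 1; the list [r] contains them
   without repetition and is indexed by the counted arrays. *)
rewrite fcoef_pleasant_sum // -(@fsbig_widen _ _ _ _ [set` r]).
- rewrite -fsbig_seq // big_seq (eq_bigr (fun=> 1)) => [|s]; last first.
    by rewrite mr fcoef_Xn => /andP[_ /eqP ->]; rewrite eqxx.
  by rewrite -big_seq big_const_seq count_predT iter_addr_0 size_map -cardE.
- by move=> s /=; rewrite mr => /andP[].
- by move=> s /= [sP nr]; apply: coef0; apply: contra_notN nr => ws; rewrite mr sP.
Qed.
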